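(* Let $n\ge2$, let $\lambda,\mu$ be dominant weights of type $A_{n-1}$ with $\lambda-\mu$ a non-negative integer combination of simple roots, and let $(w,\boldsymbol\alpha)\in S_{\lambda,\mu}$. Suppose $i,j\in\{1,\dots,n-1\}$ are such that $k_i,k_j<0$ (where $k_l=\langle w(\lambda+\rho),\alpha_l^\vee\rangle$) and $\phi_i(\boldsymbol\alpha)\neq0$ and $\phi_j(\boldsymbol\alpha)\ne0$. Then: 1. if $|i-j|>1$, then $\phi_i\phi_j(\boldsymbol\alpha)=\phi_j\phi_i(\boldsymbol\alpha)\neq0$; 2. if $|i-j|=1$, then $\phi_j\phi_i\phi_j(\boldsymbol\alpha)=\phi_i\phi_j\phi_i(\boldsymbol\alpha)\ne0$.
   Context: **Type $A_{n-1}$.** $V=\mathbb R^n/\mathbb R(1,\dots,1)$, $\varepsilon_1,\dots,\varepsilon_n\in V$ are the images of the coordinate vectors, $\Lambda=\mathbb Z^n/\mathbb Z(1,\dots,1)$ is the weight lattice, $\alpha_i=\varepsilon_i-\varepsilon_{i+1}$ ($1\le i\le n-1$) are the simple roots, and the positive roots are $\varepsilon_i-\varepsilon_j$, $1\le i<j\le n$, denoted $(i,j)$; so $(i,i+1)$ is the simple root $\alpha_i$. $\langle x,\alpha_i^\vee\rangle=x_i-x_{i+1}$. The Weyl group $W=S_n$ permutes coordinates, with simple reflections $s_i$. $\rho=(n-1,n-2,\dots,0)$. A weight $x$ is dominant if $\langle x,\alpha_i^\vee\rangle\ge 0$ for all $i$. **Kostant partitions.** $\mathcal K$ is the set of finite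 multisets $\boldsymbol\alpha$ of positive roots; $\overline{\boldsymbol\alpha}$ is the sum (with multiplicity) of the roots of $\boldsymbol\alpha$. Let $S_{\lambda,\mu}=\{(w,\boldsymbol\alpha):w\in W,\ \boldsymbol\alpha\in\mathcal K,\ \overline{\boldsymbol\alpha}=w(\lambda+\rho)-(\mu+\rho)\}$. **Words.** Let $\boldsymbol\alpha\in\mathcal K$, $1\le i\le n-1$. The word $W_i$: order the roots $(a,b)$ of $\boldsymbol\alpha$ (with multiplicity) from left to right, decreasing in $a$ and, for equal $a$, increasing in $b$; place $+$ below each $(h,i)$ and $-$ below each $(h,i+1)$ (other roots give no symbol). The word $W_i^*$: order the roots from left to right, increasing in $b$ and, for equal $b$, decreasing in $a$; place $+$ below each $(i+1,j)$ and $-$ below each $(i,j)$. The reduced words $W_i^{r}=(+)^{a_i}(-)^{b_i}$ and $W_i^{*,r}=(+)^{a_i^*}(-)^{b_i^*}$ are obtained by repeatedly cancelling pairs consisting of a $-$ and a $+$ where the $-$ is immediately to the left of the $+$ (ignoring already cancelled symbols); the remaining symbols remember the roots they lie below. **Operators on $\mathcal K$** (with values in $\mathcal K\sqcup\{0\}$, and sending $0$ to $0$): - $f_i(\boldsymbol\alpha)$: if $b_i^*<a_i$, replace the root $(h,i)$ above the rightmost $+$ of $W_i^r$ by $(h,i+1)$; if $b_i^*\ge a_i$ and $a_i^*>0$, replace the root $(i+1,j)$ above the rightmost $+$ of $W_i^{*,r}$ by $(i,j)$; otherwise $f_i(\boldsymbol\alpha)=0$. - $e_i(\boldsymbol\alpha)$: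 if $b_i^*\le a_i$, $b_i>0$ and the root $(h,i+1)$ above the leftmost $-$ of $W_i^r$ is not $(i,i+1)$, replace that root by $(h,i)$; if $b_i^*>a_i$ and the root $(i,j)$ above the leftmost $-$ of $W_i^{*,r}$ is not $(i,i+1)$, replace that root by $(i+1,j)$; otherwise $e_i(\boldsymbol\alpha)=0$. **The operators $\phi_i$.** For $(w,\boldsymbol\alpha)\in S_{\lambda,\mu}$ let $k_i=\langle w(\lambda+\rho),\alpha_i^\vee\rangle$, which is nonzero. Put $\phi_i(\boldsymbol\alpha)=f_i^{-k_i}(\boldsymbol\alpha)$ if $k_i<0$, and $\phi_i(\boldsymbol\alpha)=e_i^{k_i}(\boldsymbol\alpha)$ if $k_i>0$. On pairs, $\phi_i(w,\boldsymbol\alpha)=(s_iw,\phi_i(\boldsymbol\alpha))\in S_{\lambda,\mu}$ if $\phi_i(\boldsymbol\alpha)\ne0$, and $0$ otherwise; $\phi_i(0)=0$. A composition such as $\phi_i\phi_j(\boldsymbol\alpha)$ is computed on pairs: after applying $\phi_j$ to $(w,\boldsymbol\alpha)$, the exponent used by $\phi_i$ is computed from $s_jw$, i.e. it is $\langle s_jw(\lambda+\rho),\alpha_i^\vee\rangle$. *)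

(* Defs.v *)
From HB Require Import structures.
From mathcomp Require Import all_boot all_order all_fingroup all_algebra.
From mathcomp Require Import generic_quotient ring_quotient.
From mathcomp Require Import finmap multiset.

Set Implicit Arguments.
Unset Strict Implicit.
Unset Printing Implicit Defensive.

Import GRing.Theory Num.Theory.
Local Open Scope ring_scope.
Local Open Scope quotient_scope.

Definition diagonal (n : nat) : {pred 'rV[int]_n} :=
  [pred x : 'rV[int]_n | [forall p, forall q, x 0 p == x 0 q]].
Arguments diagonal : clear implicits.

Lemma diagonalP (n : nat) (x : 'rV[int]_n) :
  reflect (exists c : int, x = const_mx c) (x \in diagonal n).
Proof.
apply: (iffP forallP) => [x_const | [c ->] p]; last first.
  by apply/forallP => q; rewrite !mxE.
case: n x x_const => [|n] x x_const.
  by exists 0; apply/rowP => -[].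
exists (x 0 ord0); apply/rowP => p; rewrite mxE.
by apply/eqP; move/forallP: (x_const p); apply.
Qed.

Fact diagonal_zmod_closed (n : nat) : zmod_closed (diagonal n).
Proof.
split=> [|x y /diagonalP[c ->] /diagonalP[d ->]]; apply/diagonalP.
  by exists 0; apply/rowP => p; rewrite !mxE.
by exists (c - d); apply/rowP => p; rewrite !mxE.
Qed.

HB.instance Definition _ (n : nat) :=
  GRing.isZmodClosed.Build 'rV[int]_n (diagonal n) (diagonal_zmod_closed n).

(* The weight lattice Z^n / Z(1, ..., 1).  Coordinates and simple roots are   *)
(* numbered from 0: p : 'I_n is the coordinate p + 1 of the usual numbering,  *)
(* and i : 'I_n.-1 is the index of the simple root alpha_(i + 1).             *)
Notation weight n := (Quotient.quot (diagonal n)).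

Definition eps (n : nat) (p : 'I_n) : weight n :=
  \pi_(weight n) (delta_mx 0 p).

Definition lo (n : nat) (i : 'I_n.-1) : 'I_n := widen_ord (leq_pred n) i.

Fact hi_subproof (n : nat) (i : 'I_n.-1) : (i.+1 < n)%N.
Proof. by rewrite -ltn_predRL. Qed.

Definition hi (n : nat) (i : 'I_n.-1) : 'I_n := Ordinal (hi_subproof i).

Definition simple_root (n : nat) (i : 'I_n.-1) : weight n :=
  eps (lo i) - eps (hi i).

(* <x, alpha_i^vee>; see [pairing_pi] for the independence of the             *)
(* representative.                                                            *)
Definition pairing (n : nat) (x : weight n) (i : 'I_n.-1) : int :=
  repr x 0 (lo i) - repr x 0 (hi i).

(* The action of S_n with w (eps p) = eps (w p); see [weyl_act_pi].           *)
Definition weyl_act (n : nat) (w : 'S_n) (x : weight n) : weight n :=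
  \pi_(weight n) (col_perm w^-1 (repr x)).

Lemma repr_pi_const (n : nat) (x : 'rV[int]_n) :
  exists c : int, repr (\pi_(weight n) x) = x + const_mx c.
Proof.
have /diagonalP[c Ec] : repr (\pi_(weight n) x) - x \in diagonal n.
  by rewrite Quotient.idealrBE reprK.
by exists c; rewrite -Ec addrC subrK.
Qed.

Lemma pairing_pi (n : nat) (x : 'rV[int]_n) (i : 'I_n.-1) :
  pairing (\pi_(weight n) x) i = x 0 (lo i) - x 0 (hi i).
Proof.
rewrite /pairing; have [c ->] := repr_pi_const x.
by rewrite !mxE opprD addrACA subrr addr0.
Qed.

Lemma weyl_act_pi (n : nat) (w : 'S_n) (x : 'rV[int]_n) :
  weyl_act w (\pi_(weight n) x) = \pi_(weight n) (col_perm w^-1 x).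
Proof.
rewrite /weyl_act; have [c ->] := repr_pi_const x.
apply/eqP; rewrite -Quotient.idealrBE; apply/diagonalP.
by exists c; apply/rowP => p; rewrite !mxE addrC addKr.
Qed.

Lemma weyl_act_eps (n : nat) (w : 'S_n) (p : 'I_n) :
  weyl_act w (eps p) = eps (w p).
Proof.
rewrite weyl_act_pi; congr \pi; apply/rowP => q; rewrite !mxE !eqxx /=.
by congr (nat_of_bool _)%:R; rewrite -(inj_eq (@perm_inj _ w)) permKV.
Qed.

(* Permutations compose from left to right in the library, so that [w * s] is *)
(* the composite usually written s w.                                         *)
Lemma weyl_actM (n : nat) (w s : 'S_n) (x : weight n) :
  weyl_act (w * s)%g x = weyl_act s (weyl_act w x).
Proof.
rewrite -[x]reprK !weyl_act_pi; congr \pi; apply/rowP => q.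
by rewrite !mxE invMg permM reprK.
Qed.

Definition simple_reflection (n : nat) (i : 'I_n.-1) : 'S_n :=
  tperm (lo i) (hi i).

Definition rho (n : nat) : weight n :=
  \pi_(weight n) (\row_(p < n) (n.-1 - p)%N%:Z).
Arguments rho : clear implicits.

Definition dominant (n : nat) (x : weight n) : Prop :=
  forall i : 'I_n.-1, 0 <= pairing x i.

Definition nonneg_root_comb (n : nat) (x : weight n) : Prop :=
  exists c : 'I_n.-1 -> nat, x = \sum_(i < n.-1) simple_root i *+ c i.

(* The pair (a, b) stands for the positive root eps a - eps b.                *)
Definition posroot (n : nat) := {r : 'I_n * 'I_n | (r.1 < r.2)%N}.
HB.instance Definition _ (n : nat) := SubFinite.on (posroot n).

Notation kostant n := {mset (posroot n)}%mset.

Definition kostant_weight (n : nat) (A : kostant n) : weight n :=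
  \sum_(r <- A) (eps (val r).1 - eps (val r).2).

Definition in_S (n : nat) (lam mu : weight n) (w : 'S_n) (A : kostant n) :
    Prop :=
  kostant_weight A = weyl_act w (lam + rho n) - (mu + rho n).

(* A word is a sequence of symbols, each with the root it lies below;         *)
(* [true] is the symbol +, [false] is the symbol -.                           *)
Definition word (n : nat) := seq (bool * posroot n).

Definition word_order (n : nat) : rel (posroot n) := fun r s =>
  ((val s).1 < (val r).1)%N
  || ((val r).1 == (val s).1) && ((val r).2 <= (val s).2)%N.

Definition dual_word_order (n : nat) : rel (posroot n) := fun r s =>
  ((val r).2 < (val s).2)%N
  || ((val r).2 == (val s).2) && ((val s).1 <= (val r).1)%N.

Definition mark (n : nat) (i : 'I_n.-1) (r : posroot n) :
    option (bool * posroot n) :=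
  if (val r).2 == lo i then Some (true, r)
  else if (val r).2 == hi i then Some (false, r)
  else None.

Definition dual_mark (n : nat) (i : 'I_n.-1) (r : posroot n) :
    option (bool * posroot n) :=
  if (val r).1 == hi i then Some (true, r)
  else if (val r).1 == lo i then Some (false, r)
  else None.

Definition wordW (n : nat) (i : 'I_n.-1) (A : kostant n) : word n :=
  pmap (mark i) (sort (@word_order n) A).

Definition dual_wordW (n : nat) (i : 'I_n.-1) (A : kostant n) : word n :=
  pmap (dual_mark i) (sort (@dual_word_order n) A).

(* Cancels the leftmost factor -+ of the word, if there is one.               *)
Fixpoint cancel_step (n : nat) (s : word n) : word n :=
  match s with
  | [::] => [::]
  | x :: s' =>
    match s' with
    | y :: t => if ~~ x.1 && y.1 then t else x :: cancel_step s'
    | [::] => [:: x]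
    end
  end.

Definition reduce (n : nat) (s : word n) : word n :=
  iter (size s) (@cancel_step n) s.

Definition plus_roots (n : nat) (s : word n) : seq (posroot n) :=
  [seq x.2 | x <- s & x.1].

Definition minus_roots (n : nat) (s : word n) : seq (posroot n) :=
  [seq x.2 | x <- s & ~~ x.1].

(* Replaces one copy of the root r by the root q; the value None, which       *)
(* stands for 0, is returned when the pair q is not a positive root (this     *)
(* does not happen in [f_op] and [e_op] below).                               *)
Definition replace_root (n : nat) (A : kostant n) (r : posroot n)
    (q : 'I_n * 'I_n) : option (kostant n) :=
  omap (fun q' : posroot n => q' +` (A `\ r))%mset (insub q).

Definition olast (T : Type) (s : seq T) : option T := ohead (rev s).

Definition f_op (n : nat) (i : 'I_n.-1) (A : kostant n) : option (kostant n) :=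
  let W := reduce (wordW i A) in
  let V := reduce (dual_wordW i A) in
  let a := size (plus_roots W) in
  let a' := size (plus_roots V) in
  let b' := size (minus_roots V) in
  if (b' < a)%N then
    obind (fun r => replace_root A r ((val r).1, hi i)) (olast (plus_roots W))
  else if (0 < a')%N then
    obind (fun r => replace_root A r (lo i, (val r).2)) (olast (plus_roots V))
  else None.

Definition e_op (n : nat) (i : 'I_n.-1) (A : kostant n) : option (kostant n) :=
  let W := reduce (wordW i A) in
  let V := reduce (dual_wordW i A) in
  let a := size (plus_roots W) in
  let b := size (minus_roots W) in
  let b' := size (minus_roots V) in
  if (b' <= a)%N then
    if (0 < b)%N then
      obind (fun r =>
          if val r == (lo i, hi i) then None
          else replace_root A r ((val r).1, lo i))
        (ohead (minus_roots W))
    else None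
  else
    obind (fun r =>
        if val r == (lo i, hi i) then None
        else replace_root A r (hi i, (val r).2))
      (ohead (minus_roots V)).

Definition opow (T : Type) (g : T -> option T) (m : nat) (x : T) : option T :=
  iter m (obind g) (Some x).

(* phi_i(A), for A the second component of the pair (w, A).  The case k = 0   *)
(* does not occur when lam is dominant, since lam + rho is then regular.      *)
Definition phi_kostant (n : nat) (lam : weight n) (i : 'I_n.-1) (w : 'S_n)
    (A : kostant n) : option (kostant n) :=
  let k := pairing (weyl_act w (lam + rho n)) i in
  if k < 0 then opow (f_op i) `|k|%N A else opow (e_op i) `|k|%N A.

Definition phi (n : nat) (lam : weight n) (i : 'I_n.-1)
    (x : option ('S_n * kostant n)) : option ('S_n * kostant n) :=
  obind (fun wA : 'S_n * kostant n =>
      omap (pair (wA.1 * simple_reflection i)%g)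
        (phi_kostant lam i wA.1 wA.2)) x.

(* The composite phi_(i1) phi_(i2) ... (A), whose rightmost factor acts       *)
(* first, computed on pairs starting from (w, A).                             *)
Definition phi_comp (n : nat) (lam : weight n) (s : seq 'I_n.-1) (w : 'S_n)
    (A : kostant n) : option (kostant n) :=
  omap snd (foldr (phi lam) (Some (w, A)) s).

(* Main.v *)
Require Import Defs.
From mathcomp Require Import all_boot all_order all_fingroup all_algebra.
From mathcomp Require Import generic_quotient ring_quotient finmap multiset.
From mathcomp Require Import zify.

(* The operator f_i changes the rightmost uncancelled + of the concatenated   *)
(* word W_i^* W_i, so it is the crystal operator of a tensor product, and it  *)
(* can be applied -k_i times because, mu being dominant, that word has at     *)
(* least -k_i more + than -.                                                  *)
(* For |i - j| > 1 the operators f_i and f_j interact only through the        *)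
(* multiplicities of (i, j), (i, j+1), (i+1, j), (i+1, j+1), and commute.     *)
(* For j = i + 1 the words W_i^* W_i and W_j^* W_j are the signatures of one  *)
(* word in the letters 1, 2, 3 and their duals, in which the roots (i, i+1),  *)
(* (i, i+2) and (i+1, i+2) occur twice; depending on which of the first and   *)
(* last multiplicities is larger, one of the two copies never moves and acts  *)
(* as a constant lowest weight factor.  Row insertion maps such a word to a   *)
(* tableau, commutes with the operators, and is injective once the history of *)
(* shapes is recorded.  On tableaux with entries 1, 2, 3 the powers of f_1    *)
(* and f_2 are explicit and the identity f_2^a f_1^(a+b) f_2^b =              *)
(* f_1^b f_2^(a+b) f_1^a is piecewise linear.                                 *)

(** Indices are numbered from 0, so (i, i+1) is the simple root of index i. [f_op_loc] gives f_i by
    the signature rule on W_i^* W_i. The number of + minus the number of - in that word is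
    [weight_of], minus the pairing of the weight of the multiset with the coroot; it is at least
    -k_i ([in_S_weight]) and bounds the number of uncancelled + from below ([weight_le_phi]). With a
    = -k_i and b = -k_j this makes both adjacent composites non-zero ([phi_comp_adj_some]).

    For distant indices, single steps close up into a diamond ([f_op_comm]), which extends to powers
    ([opow_comm]).

    For adjacent indices the equality is f_j^a f_i^(a+b) f_j^b = f_i^b f_j^(a+b) f_i^a
    ([phi_comp_adj], [f_op_braid]). It is computed on tableaux ([tab_braid]) and pulled back to
    words in 1, 2, 3 ([word_braid]), to words that also contain dual letters ([factor_braid]), and
    through [encode] to multisets. Each passage commutes with the operators and becomes injective
    once some data preserved by the operators are fixed: the shapes, the kinds of the factors, the
    untouched roots. *)

Set Implicit Arguments.
Unset Strict Implicit.
Unset Printing Implicit Defensive.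

Import GRing.Theory Num.Theory.

(** * Tableaux with entries 1, 2, 3 *)

(* A pair (x, y) stands for the word +^x -^y.  Lists of such blocks are read  *)
(* from right to left: their head is the rightmost block of the word, and e   *)
(* is the number of uncancelled - to the left of the whole list.              *)
Fixpoint sig_eps (T : Type) (g : T -> nat * nat) (e : nat) (s : seq T) : nat :=
  if s is t :: s' then (g t).2 + (sig_eps g e s' - (g t).1) else e.

Fixpoint sig_phi (T : Type) (g : T -> nat * nat) (e : nat) (s : seq T) : nat :=
  if s is t :: s' then sig_phi g e s' + ((g t).1 - sig_eps g e s') else 0.

Fixpoint sig_loc (T : Type) (g : T -> nat * nat) (e : nat) (s : seq T) :
    option T :=
  if s is t :: s' then
    if sig_eps g e s' < (g t).1 then Some t else sig_loc g e s'
  else None.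

Fixpoint sig_move (T : Type) (g : T -> nat * nat) (mv : T -> T) (s : seq T) :
    option (seq T) :=
  if s is t :: s' then
    if sig_eps g 0 s' < (g t).1 then Some (mv t :: s')
    else omap (cons t) (sig_move g mv s')
  else None.

Lemma sig_eps_cons (T : Type) (g : T -> nat * nat) (e : nat) (t : T)
    (s : seq T) :
  sig_eps g e (t :: s) = (g t).2 + (sig_eps g e s - (g t).1).
Proof. by []. Qed.

Lemma sig_move_cons (T : Type) (g : T -> nat * nat) (mv : T -> T) (t : T)
    (s : seq T) :
  sig_move g mv (t :: s)
  = if sig_eps g 0 s < (g t).1 then Some (mv t :: s)
    else omap (cons t) (sig_move g mv s).
Proof. by []. Qed.

(** [(x, y, z)] is the row word 1^x 2^y 3^z. The signs are those of f_1 (+ under 1, - under 2) for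
    [k = false], of f_2 for [k = true]. *)
Definition row_blk (k : bool) (t : nat * nat * nat) : nat * nat :=
  let: (x, y, z) := t in if k then (y, z) else (x, y).

Definition row_mv (k : bool) (t : nat * nat * nat) : nat * nat * nat :=
  let: (x, y, z) := t in if k then (x, y.-1, z.+1) else (x.-1, y.+1, z).

Notation row3 := (nat * nat * nat)%type.

Definition row_size (t : row3) : nat := t.1.1 + t.1.2 + t.2.

(** Row insertion of the whole row [t] into [s]: the x ones displace twos and then, if x exceeds v,
    x - v threes; the y twos displace further threes. [row_bump] collects the displaced letters and
    [row_insert] is the new row. *)
Definition row_bump (s t : row3) : row3 :=
  let: (u, v, w) := s in let: (x, y, z) := t in
  (0, minn v x, minn w ((x - v) + y)).

Definition row_insert (s t : row3) : row3 :=
  let: (u, v, w) := s in let: (x, y, z) := t in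
  (u + x, (v - x) + y, (w - ((x - v) + y)) + z).

Lemma sig_eps_row_bump (k : bool) (e : nat) (s t : row3) :
  sig_eps (row_blk k) e [:: row_insert s t; row_bump s t]
  = sig_eps (row_blk k) e [:: t; s].
Proof.
by case: s t => [[u v] w] [[x y] z]; case: k => /=; case: (leqP v x) => ?; lia.
Qed.

Definition move2 (k : bool) (e : nat) (s t : row3) : option (row3 * row3) :=
  if sig_eps (row_blk k) e [:: s] < (row_blk k t).1 then Some (s, row_mv k t)
  else if e < (row_blk k s).1 then Some (row_mv k s, t)
  else None.

(** Two-row case of the compatibility of insertion with f_1 and f_2; e counts the uncancelled -
    coming from further left. *)
Lemma move2_row_bump (k : bool) (e : nat) (s t : row3) :
  move2 k e (row_bump s t) (row_insert s t)
  = omap (fun st => (row_bump st.1 st.2, row_insert st.1 st.2)) (move2 k e s t).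
Proof.
case: s t => [[u v] w] [[x y] z]; case: k; rewrite /move2 /=.
  case: (leqP v x) => ? /=; last rewrite (_ : x - v = 0); try lia.
    rewrite (_ : v - x = 0) ?add0n /=; last lia.
  all: do 4?(case: ltnP => /= ?); try (exfalso; lia); try by [].
  all: congr Some; congr (_, _, _, (_, _, _)); lia.
all: do 4?(case: ltnP => /= ?); try (exfalso; lia); try by [].
all: congr Some; congr (_, _, _, (_, _, _)); lia.
Qed.

(** Reverse bumping: once the length of the old row is known, the displaced letters can be put
    back. *)
Lemma row_bump_insert_inj (s t s' t' : row3) :
  row_size s = row_size s' ->
  row_bump s t = row_bump s' t' -> row_insert s t = row_insert s' t' ->
  s = s' /\ t = t'.
Proof.
case: s t s' t' => [[u v] w] [[x y] z] [[u' v'] w'] [[x' y'] z'].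
rewrite /row_size /= => eN.
case=> e1 e2 [e3 e4 e5].
have Ex : x = x'.
  case: (leqP v x) => ?; case: (leqP v' x') => ?; lia.
subst x'; have Eu : u = u' by lia.
subst u'; have Ev : v = v' by lia.
subst v'; have Ew : w = w' by lia.
subst w'; have Ey : y = y' by lia.
subst y'; have Ez : z = z' by lia.
by subst z'.
Qed.

Fixpoint tab_insert (P : seq row3) (t : row3) : seq row3 :=
  if P is r :: P' then row_insert r t :: tab_insert P' (row_bump r t)
  else [:: t].

Lemma sig_eps_tab_insert (k : bool) (e : nat) (P : seq row3) (t : row3) :
  sig_eps (row_blk k) e (tab_insert P t) = sig_eps (row_blk k) e (t :: P).
Proof.
elim: P t => [//|r P IH] t /=; rewrite IH.
exact: (sig_eps_row_bump k (sig_eps (row_blk k) e P) r t).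
Qed.

Lemma sig_move_tab_insert (k : bool) (P : seq row3) (t : row3) :
  sig_move (row_blk k) (row_mv k) (tab_insert P t)
  = omap (fun L => if L is t' :: P' then tab_insert P' t' else [::])
      (sig_move (row_blk k) (row_mv k) (t :: P)).
Proof.
elim: P t => [|r P IH] t; first by rewrite /=; case: ifP.
rewrite [tab_insert _ _]/= !sig_move_cons IH sig_eps_tab_insert !sig_move_cons.
have := move2_row_bump k (sig_eps (row_blk k) 0 P) r t; rewrite /move2.
rewrite -!/(sig_eps _ 0 (_ :: P)) /=.
do 2!(case: ifP => _); do ?case: ifP => _ //=; try by move=> /= [-> ->].
by case: (sig_move _ _ P).
Qed.

Notation tableau := (row3 * row3 * row3)%type.

Definition tab_rows (P : tableau) : seq row3 := [:: P.1.1; P.1.2; P.2].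

(** Semistandardness in terms of multiplicities: no 1 in the second row, only 3 in the third,
    columns strictly increasing. *)
Definition tableau_wf (P : tableau) : Prop :=
  let: ((u, v, w), (u2, v2, w2), (u3, v3, w3)) := P in
  [/\ u2 = 0, u3 = 0, v3 = 0 & [/\ v2 <= u, v2 + w2 <= u + v & w3 <= v2]].

Definition tab_add (P : tableau) (t : row3) : tableau :=
  let: (r1, r2, r3) := P in
  let b1 := row_bump r1 t in
  let b2 := row_bump r2 b1 in
  (row_insert r1 t, row_insert r2 b1, row_insert r3 b2).

(** A strictly increasing column in three letters has at most three entries, so nothing is bumped
    out of the third row. *)
Lemma tab_rows_add (P : tableau) (t : row3) : tableau_wf P ->
  tab_insert (tab_rows P) t = rcons (tab_rows (tab_add P t)) (0, 0, 0).
Proof.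
case: P t => [[[[u v] w] [[u2 v2] w2]] [[u3 v3] w3]] [[x y] z].
case=> -> -> -> _ /=; rewrite /tab_rows /=; congr [:: _; _; _; (_, _, _)]; lia.
Qed.

Lemma tab_add_wf (P : tableau) (t : row3) : tableau_wf P ->
  tableau_wf (tab_add P t).
Proof.
case: P t => [[[[u v] w] [[u2 v2] w2]] [[u3 v3] w3]] [[x y] z].
case=> -> -> -> [? ? ?] /=.
split; first [lia | split]; case: (leqP v x) => ? /=; lia.
Qed.

Lemma sig_eps_rcons0 (k : bool) (L : seq row3) :
  sig_eps (row_blk k) 0 (rcons L (0, 0, 0)) = sig_eps (row_blk k) 0 L.
Proof. by elim: L => [|t L IH] /=; [case: k | rewrite IH]. Qed.

Lemma sig_move_rcons0 (k : bool) (L : seq row3) :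
  sig_move (row_blk k) (row_mv k) (rcons L (0, 0, 0))
  = omap (rcons^~ (0, 0, 0)) (sig_move (row_blk k) (row_mv k) L).
Proof.
elim: L => [|t L IH] /=; first by case: k.
rewrite sig_eps_rcons0 IH; case: ifP => _ //.
by case: (sig_move _ _ L).
Qed.

Definition tab_size (P : tableau) : nat * nat * nat :=
  let: (r1, r2, r3) := P in (row_size r1, row_size r2, row_size r3).

Lemma tab_add_inj (P P' : tableau) (t t' : row3) :
  tableau_wf P -> tableau_wf P' -> tab_size P = tab_size P' ->
  tab_add P t = tab_add P' t' -> P = P' /\ t = t'.
Proof.
case: P P' => [[r1 r2] r3] [[r1' r2'] r3'] wfP wfP' [N1 N2 N3] eI.
(* The empty fourth row is kept as the letters bumped out of the third; from it the rows are
   un-inserted from the last to the first. *)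
have := congr1 (fun P => rcons (tab_rows P) (0, 0, 0)) eI.
rewrite -!tab_rows_add //= => -[e1 e2 e3 e4].
have [-> e5] := row_bump_insert_inj N3 e4 e3.
have [-> e6] := row_bump_insert_inj N2 e5 e2.
by have [-> ->] := row_bump_insert_inj N1 e6 e1.
Qed.

Lemma size_sig_move (T : Type) (g : T -> nat * nat) (mv : T -> T)
    (s s' : seq T) :
  sig_move g mv s = Some s' -> size s' = size s.
Proof.
elim: s s' => [//|t s IH] s' /=; case: ifP => _; first by case=> <-.
by case E: sig_move => [s1|] //= [<-] /=; rewrite (IH _ E).
Qed.

Definition tab_of (L : seq row3) : tableau :=
  (nth (0, 0, 0) L 0, nth (0, 0, 0) L 1, nth (0, 0, 0) L 2).

Definition tab_move (k : bool) (P : tableau) : option tableau :=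
  omap tab_of (sig_move (row_blk k) (row_mv k) (tab_rows P)).

Lemma tab_moveP (k : bool) (P : tableau) :
  sig_move (row_blk k) (row_mv k) (tab_rows P) = omap tab_rows (tab_move k P).
Proof.
rewrite /tab_move; case E: sig_move => [L|] //=; congr Some.
by have := size_sig_move E; case: L {E} => [|a [|b [|c []]]].
Qed.

Lemma row_size_mv (k : bool) (t : row3) :
  0 < (row_blk k t).1 -> row_size (row_mv k t) = row_size t.
Proof. by case: t => [[x y] z]; rewrite /row_size; case: k => /=; lia. Qed.

Lemma tab_move_size (k : bool) (P P' : tableau) :
  tab_move k P = Some P' -> tab_size P' = tab_size P.
Proof.
case: P => [[r1 r2] r3]; rewrite /tab_move [tab_rows _]/= !sig_move_cons /=.
case: ifP => [lt_eps /= [<-]|_]; last case: ifP => [lt_eps /= [<-]|_].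
- by rewrite /tab_size /= row_size_mv //; apply: leq_ltn_trans lt_eps.
- by rewrite /tab_size /= row_size_mv //; apply: leq_ltn_trans lt_eps.
case: ifP => [lt_eps /= [<-]|_] //.
by rewrite /tab_size /= row_size_mv.
Qed.

Lemma tab_move_wf (k : bool) (P P' : tableau) :
  tableau_wf P -> tab_move k P = Some P' -> tableau_wf P'.
Proof.
case: P => [[[[u v] w] [[u2 v2] w2]] [[u3 v3] w3]].
case=> -> -> -> [? ? ?]; rewrite /tab_move /=.
case: k => /=; case: ltnP => [? /= [<-]|?] /=;
  try (split; first [lia | split; lia]).
  case: ltnP => [? /= [<-]|?] /=; try (split; first [lia | split; lia]).
all: by [].
Qed.

Arguments tab_insert : simpl never.

Lemma tab_move_add (k : bool) (P : tableau) (t : row3) : tableau_wf P ->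
  tab_move k (tab_add P t)
  = if sig_eps (row_blk k) 0 (tab_rows P) < (row_blk k t).1
    then Some (tab_add P (row_mv k t))
    else omap (tab_add^~ t) (tab_move k P).
Proof.
move=> wfP; have := sig_move_tab_insert k (tab_rows P) t.
rewrite tab_rows_add // sig_move_rcons0 tab_moveP sig_move_cons tab_moveP.
case: ifP => _ /=.
  rewrite tab_rows_add //; case: (tab_move _ (tab_add _ _)) => [P'|] //=.
  by case; case: P' => [[r1 r2] r3] /= -> -> ->; rewrite -!surjective_pairing.
case EP: (tab_move k P) => [P1|] /=.
  rewrite tab_rows_add; last exact: tab_move_wf EP.
  case: (tab_move _ (tab_add _ _)) => [P'|] //=.
  by case; case: P' => [[r1 r2] r3] /= -> -> ->; rewrite -!surjective_pairing.
by case: (tab_move _ (tab_add _ _)).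
Qed.

Fixpoint word_tab (L : seq row3) : tableau :=
  if L is t :: L' then tab_add (word_tab L') t
  else ((0, 0, 0), (0, 0, 0), (0, 0, 0)).

(* Plays the role of the recording tableau. *)
Fixpoint word_shapes (L : seq row3) : seq (nat * nat * nat) :=
  if L is t :: L' then tab_size (word_tab L') :: word_shapes L' else [::].

Lemma word_tab_wf (L : seq row3) : tableau_wf (word_tab L).
Proof. by elim: L => [|t L IH] //=; apply: tab_add_wf. Qed.

Lemma sig_eps_word_tab (k : bool) (L : seq row3) :
  sig_eps (row_blk k) 0 (tab_rows (word_tab L)) = sig_eps (row_blk k) 0 L.
Proof.
elim: L => [|t L IH]; first by case: k.
rewrite [word_tab _]/= -sig_eps_rcons0 -tab_rows_add; last exact: word_tab_wf.
by rewrite sig_eps_tab_insert sig_eps_cons IH.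
Qed.

Lemma tab_move_word_tab (k : bool) (L : seq row3) :
  tab_move k (word_tab L)
  = omap word_tab (sig_move (row_blk k) (row_mv k) L).
Proof.
elim: L => [|t L IH]; first by case: k.
rewrite [word_tab _]/= tab_move_add; last exact: word_tab_wf.
rewrite sig_eps_word_tab sig_move_cons; case: ifP => _ //.
by rewrite IH; case: sig_move.
Qed.

Lemma word_shapes_move (k : bool) (L L' : seq row3) :
  sig_move (row_blk k) (row_mv k) L = Some L' -> word_shapes L' = word_shapes L.
Proof.
elim: L L' => [//|t L IH] L'; rewrite sig_move_cons; case: ifP => _.
  by case=> <-.
case E: sig_move => [L1|] //= [<-] /=; rewrite (IH _ E); congr cons.
by apply: (@tab_move_size k); rewrite tab_move_word_tab E.
Qed.

(** Injectivity of the Robinson-Schensted-Knuth correspondence: the successive shapes allow the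
    insertions to be undone one row at a time. *)
Lemma word_tab_inj (L L' : seq row3) :
  word_shapes L = word_shapes L' -> word_tab L = word_tab L' -> L = L'.
Proof.
elim: L L' => [|t L IH] [|t' L'] //= [eS eSs] eT.
have [eL ->] := tab_add_inj (word_tab_wf L) (word_tab_wf L') eS eT.
by rewrite (IH L').
Qed.

(** The v2 twos of the second row cancel v2 ones of the first; the u - v2 remaining ones are all in
    the first row. *)
Lemma tab_move_pow1 (c : nat) (u v w v2 w2 w3 : nat) :
  v2 <= u -> c <= u - v2 ->
  opow (tab_move false) c ((u, v, w), (0, v2, w2), (0, 0, w3))
  = Some ((u - c, v + c, w), (0, v2, w2), (0, 0, w3)).
Proof.
move=> le_u; elim: c => [|c IH] le_c.
  by rewrite /opow /= subn0 addn0.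
rewrite /opow iterS -/(opow _ _ _) IH; last lia.
rewrite /tab_move /= ifT; last lia.
rewrite /=; congr (Some (_, _, _, _, _)); lia.
Qed.

(** The uncancelled 2s are v - w2 in the first row (none if w2 >= v), which are used first, and v2 -
    w3 in the second. *)
Lemma tab_move_pow2 (c : nat) (u v w v2 w2 w3 : nat) :
  w3 <= v2 -> c <= (v - w2) + (v2 - w3) ->
  opow (tab_move true) c ((u, v, w), (0, v2, w2), (0, 0, w3))
  = let d := minn c (v - w2) in
    Some ((u, v - d, w + d), (0, v2 - (c - d), w2 + (c - d)), (0, 0, w3)).
Proof.
move=> le_w; elim: c => [|c IH] le_c.
  by rewrite /opow /= min0n !subn0 !addn0.
rewrite /opow iterS -/(opow _ _ _) IH; last lia.
rewrite /tab_move /=; case: (leqP c.+1 (v - w2)) => ?.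
  rewrite ifT; last lia.
  rewrite /=; congr (Some (_, _, _, (_, _, _), _)); lia.
rewrite ifF; last lia.
rewrite ifT; last lia.
rewrite /=; congr (Some (_, _, _, (_, _, _), _)); lia.
Qed.

(** The bounds say that a is at most the number of 1s minus that of 2s, and b the number of 2s minus
    that of 3s. They keep every power within the range of the closed formulas, whose results agree
    as piecewise linear expressions. *)
Lemma tab_braid (a b : nat) (P : tableau) : tableau_wf P ->
  let: ((u, v, w), (_, v2, w2), (_, _, w3)) := P in
  a + v + v2 <= u -> b + w + w2 + w3 <= v + v2 ->
  exists P' : tableau,
    obind (opow (tab_move true) a) (obind (opow (tab_move false) (a + b))
      (opow (tab_move true) b P)) = Some P'
    /\ obind (opow (tab_move false) b) (obind (opow (tab_move true) (a + b))
      (opow (tab_move false) a P)) = Some P'.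
Proof.
case: P => [[[[u v] w] [[u2 v2] w2]] [[u3 v3] w3]].
case=> -> -> -> [? ? ?] le_a le_b.
eexists; split.
  rewrite tab_move_pow2; [rewrite /= | lia | lia].
  rewrite tab_move_pow1; [rewrite /= | lia | lia].
  by rewrite tab_move_pow2; [rewrite /= | lia | lia].
rewrite tab_move_pow1; [rewrite /= | lia | lia].
rewrite tab_move_pow2; [rewrite /= | lia | lia].
rewrite tab_move_pow1; [rewrite /= | lia | lia].
congr (Some (_, _, _, (_, _, _), _)).
all: by case: (leqP b (v - w2)) => ?; lia.
Qed.

(** * The braid relation for words *)

Fixpoint sig_sum1 (T : Type) (g : T -> nat * nat) (s : seq T) : nat :=
  if s is t :: s' then (g t).1 + sig_sum1 g s' else 0.

Fixpoint sig_sum2 (T : Type) (g : T -> nat * nat) (s : seq T) : nat :=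
  if s is t :: s' then (g t).2 + sig_sum2 g s' else 0.

(** Cancellation removes as many + as -. *)
Lemma sig_phi_eps (T : Type) (g : T -> nat * nat) (e : nat) (s : seq T) :
  sig_phi g e s + (sig_sum2 g s + e) = sig_eps g e s + sig_sum1 g s.
Proof. by elim: s => [|t s] //=; lia. Qed.

Lemma opow_omap (T U : Type) (f : T -> option T) (h : U -> option U)
    (W : T -> U) (c : nat) (x : T) :
  (forall x, h (W x) = omap W (f x)) ->
  opow h c (W x) = omap W (opow f c x).
Proof.
move=> hW; rewrite /opow; elim: c => [|c IH] //=; rewrite IH.
by case: (iter c _ _) => [y|] //=.
Qed.

Lemma opow_inv (T : Type) (f : T -> option T) (U : Type) (I : T -> U)
    (c : nat) (x y : T) :
  (forall x y, f x = Some y -> I y = I x) ->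
  opow f c x = Some y -> I y = I x.
Proof.
move=> fI; rewrite /opow; elim: c y => [|c IH] y /=; first by case=> ->.
case E: (iter c _ _) => [z|] //= /fI ->; exact: IH.
Qed.

Lemma tab_add_sum (k : bool) (P : tableau) (t : row3) : tableau_wf P ->
  sig_sum1 (row_blk k) (tab_rows (tab_add P t))
  + (sig_sum2 (row_blk k) (tab_rows P) + (row_blk k t).2)
  = (sig_sum1 (row_blk k) (tab_rows P) + (row_blk k t).1)
  + sig_sum2 (row_blk k) (tab_rows (tab_add P t)).
Proof.
case: P t => [[[[u v] w] [[u2 v2] w2]] [[u3 v3] w3]] [[x y] z].
case=> -> -> -> _; case: k => /=; lia.
Qed.

Lemma word_tab_sum (k : bool) (L : seq row3) :
  sig_sum1 (row_blk k) (tab_rows (word_tab L)) + sig_sum2 (row_blk k) L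
  = sig_sum1 (row_blk k) L + sig_sum2 (row_blk k) (tab_rows (word_tab L)).
Proof.
elim: L => [|t L]; first by case: k.
have := tab_add_sum k t (word_tab_wf L).
rewrite [word_tab (_ :: _)]/= [sig_sum1 _ (_ :: L)]/= [sig_sum2 _ (_ :: L)]/=.
by lia.
Qed.

Definition braid_ok (T : Type) (f : bool -> T -> option T) (a b : nat)
    (x : T) : Prop :=
  exists y : T,
    obind (opow (f true) a) (obind (opow (f false) (a + b))
      (opow (f true) b x)) = Some y
    /\ obind (opow (f false) b) (obind (opow (f true) (a + b))
      (opow (f false) a x)) = Some y.

(** Pulls the relation back along [W]: the two results have the same image and, as each operator
    preserves [I], the same invariant; together these determine the element. *)
Lemma braid_ok_inj (T U V : Type) (f : bool -> T -> option T)
    (h : bool -> U -> option U) (W : T -> U) (I : T -> V) (a b : nat) (x : T) :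
  (forall k x, h k (W x) = omap W (f k x)) ->
  (forall k x y, f k x = Some y -> I y = I x) ->
  (forall x y, I x = I y -> W x = W y -> x = y) ->
  braid_ok h a b (W x) -> braid_ok f a b x.
Proof.
move=> hW fI WI [y []]; have H k := opow_omap _ _ (hW k).
have HI k c x1 x2 := @opow_inv _ _ _ I c x1 x2 (fI k).
rewrite !H; case E1: (opow _ _ x) => [x1|] //=; rewrite H.
case E2: (opow _ _ x1) => [x2|] //=; rewrite H.
case E3: (opow _ _ x2) => [x3|] //= [e3].
case E4: (opow _ _ x) => [x4|] //=; rewrite H.
case E5: (opow _ _ x4) => [x5|] //=; rewrite H.
case E6: (opow _ _ x5) => [x6|] //= [e6].
have e : x3 = x6.
  apply: WI; last by rewrite e3 e6.
  rewrite (HI _ _ _ _ E3) (HI _ _ _ _ E2) (HI _ _ _ _ E1).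
  by rewrite (HI _ _ _ _ E6) (HI _ _ _ _ E5) (HI _ _ _ _ E4).
by exists x3; rewrite E1 /= E2 /= E3 E4 /= E5 /= E6 e.
Qed.

Lemma word_braid (a b : nat) (L : seq row3) :
  a + sig_sum2 (row_blk false) L <= sig_sum1 (row_blk false) L ->
  b + sig_sum2 (row_blk true) L <= sig_sum1 (row_blk true) L ->
  braid_ok (fun k => sig_move (row_blk k) (row_mv k)) a b L.
Proof.
move=> le_a le_b.
apply: (@braid_ok_inj _ _ _ _ tab_move word_tab word_shapes).
- by move=> k x; apply: tab_move_word_tab.
- by move=> k x y; apply: word_shapes_move.
- by move=> x y; apply: word_tab_inj.
have := @tab_braid a b (word_tab L) (word_tab_wf L).
have := word_tab_sum false L; have := word_tab_sum true L.
case: (word_tab L) (word_tab_wf L) => [[[[u v] w] [[u2 v2] w2]] [[u3 v3] w3]].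
case=> -> -> -> _; rewrite /= => e1 e2; apply; lia.
Qed.

(* A factor [(true, (x, y, z))] stands for a row of the dual letters          *)
(* 3* 2* 1*; it acts as the tableau with rows 1^(x+y) 2^z and 2^x 3^(y+z).    *)
Notation factor := (bool * row3)%type.

Definition fac_blk (k : bool) (t : factor) : nat * nat :=
  row_blk (t.1 (+) k) t.2.

Definition fac_mv (k : bool) (t : factor) : factor :=
  (t.1, row_mv (t.1 (+) k) t.2).

Fixpoint fac_rows (s : seq factor) : seq row3 :=
  if s is (d, (x, y, z)) :: s' then
    if d then [:: (x + y, z, 0), (0, x, y + z) & fac_rows s']
    else (x, y, z) :: fac_rows s'
  else [::].

Lemma sig_eps_fac_rows (k : bool) (s : seq factor) :
  sig_eps (row_blk k) 0 (fac_rows s) = sig_eps (fac_blk k) 0 s.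
Proof.
elim: s => [|[[] [[x y] z]] s IH] //=; rewrite {}IH //.
by case: k => /=; lia.
Qed.

(** The dual letters 3*, 2*, 1* are the columns 12, 13, 23. So f_2, taking 12 to 13, changes only
    the second row, and f_1, taking 13 to 23, only the first. *)
Lemma sig_move_fac_rows (k : bool) (s : seq factor) :
  sig_move (row_blk k) (row_mv k) (fac_rows s)
  = omap fac_rows (sig_move (fac_blk k) (fac_mv k) s).
Proof.
elim: s => [|[[] [[x y] z]] s IH] //=;
  rewrite sig_eps_fac_rows {}IH; last first.
  case: ifP => _ /=; first by case: k.
  by case: (sig_move _ _ s).
case: k => /=.
  rewrite ifF; last lia.
  case: ltnP => ? /=; first by congr (Some [:: (_, _, _), (_, _, _) & _]); lia.
  by case: (sig_move _ _ s).
rewrite (_ : _ < x + y = (sig_eps (fac_blk false) 0 s < y)); last lia.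
case: ltnP => ? /=; first by congr (Some [:: (_, _, _), (_, _, _) & _]); lia.
by case: (sig_move _ _ s).
Qed.

Lemma fac_rows_sum (k : bool) (s : seq factor) :
  sig_sum1 (row_blk k) (fac_rows s) + sig_sum2 (fac_blk k) s
  = sig_sum1 (fac_blk k) s + sig_sum2 (row_blk k) (fac_rows s).
Proof.
elim: s => [|[d [[x y] z]] s IH] //.
case: d => /=.
  by case: k IH => /= IH; lia.
by case: k IH => /= IH; lia.
Qed.

Lemma fac_rows_inj (s s' : seq factor) :
  map fst s = map fst s' -> fac_rows s = fac_rows s' -> s = s'.
Proof.
elim: s s' => [|[d [[x y] z]] s IH] [|[d' [[x' y'] z']] s'] //= [<- es].
case: d => /= -[e1 e2 e3].
  move=> e4 e5; rewrite (IH s') // e3 e2.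
  by rewrite (_ : y = y') //; lia.
by move=> e4; rewrite (IH s') // e1 e2 e3.
Qed.

Lemma fst_sig_move_fac (k : bool) (s s' : seq factor) :
  sig_move (fac_blk k) (fac_mv k) s = Some s' -> map fst s' = map fst s.
Proof.
elim: s s' => [|t s IH] s' //=; case: ifP => _; first by case=> <-.
by case E: sig_move => [s1|] //= [<-] /=; rewrite (IH s1).
Qed.

Lemma factor_braid (a b : nat) (s : seq factor) :
  a + sig_sum2 (fac_blk false) s <= sig_sum1 (fac_blk false) s ->
  b + sig_sum2 (fac_blk true) s <= sig_sum1 (fac_blk true) s ->
  braid_ok (fun k => sig_move (fac_blk k) (fac_mv k)) a b s.
Proof.
move=> le_a le_b; apply: (@braid_ok_inj _ _ _ _
  (fun k => sig_move (row_blk k) (row_mv k)) fac_rows (map fst)).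
- by move=> k x; apply: sig_move_fac_rows.
- by move=> k x y; apply: fst_sig_move_fac.
- exact: fac_rows_inj.
apply: word_braid.
  by have := fac_rows_sum false s; lia.
by have := fac_rows_sum true s; lia.
Qed.

(** * Sign words and stacks *)

(* The stacks of uncancelled + and - signs, with the rightmost sign on top. *)
Definition stack_step (T : Type) (PM : seq T * seq T) (x : bool * T) :
    seq T * seq T :=
  if x.1 then if PM.2 is _ :: M then (PM.1, M) else (x.2 :: PM.1, [::])
  else (PM.1, x.2 :: PM.2).

Definition stacks (T : Type) (PM : seq T * seq T) (s : seq (bool * T)) :
    seq T * seq T :=
  foldl (@stack_step T) PM s.

Lemma stacks_cat (T : Type) (PM : seq T * seq T) (s1 s2 : seq (bool * T)) :
  stacks PM (s1 ++ s2) = stacks (stacks PM s1) s2.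
Proof. exact: foldl_cat. Qed.

Lemma stacks_rcons (T : Type) (PM : seq T * seq T) (s : seq (bool * T))
    (x : bool * T) :
  stacks PM (rcons s x) = stack_step (stacks PM s) x.
Proof. exact: foldl_rcons. Qed.

Lemma stacks_map (T U : Type) (f : T -> U) (P M : seq T)
    (s : seq (bool * T)) :
  stacks (map f P, map f M) [seq (x.1, f x.2) | x <- s]
  = (map f (stacks (P, M) s).1, map f (stacks (P, M) s).2).
Proof.
elim: s P M => [|[[] x] s IH] P M //=; rewrite /stack_step /=; last first.
  exact: (IH P (x :: M)).
by case: M => [|m M] /=; [exact: (IH (x :: P) [::]) | exact: IH].
Qed.

(** Alone, [s] reduces to some + followed by some -. The waiting - of [M0] cancel the leftmost of
    these +, which lie at the bottom of the stack. *)
Lemma stacks_from (T : Type) (P0 M0 : seq T) (s : seq (bool * T)) :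
  stacks (P0, M0) s
  = (take (size (stacks ([::], [::]) s).1 - size M0) (stacks ([::], [::]) s).1
       ++ P0,
     (stacks ([::], [::]) s).2 ++ drop (size (stacks ([::], [::]) s).1) M0).
Proof.
elim/last_ind: s => [|s [b x] IH]; first by rewrite /= drop0.
rewrite !stacks_rcons IH {IH}; case: (stacks ([::], [::]) s) => P M.
case: b; rewrite /stack_step //=; case: M => [|m M] //=.
case: (leqP (size M0) (size P)) => leMP.
  by rewrite !drop_oversize ?subSn //= leqW.
rewrite (_ : size P - size M0 = 0); last by apply/eqP; rewrite subn_eq0 ltnW.
rewrite (_ : _.+1 - _ = 0); last by apply/eqP; rewrite subn_eq0.
by rewrite !take0 (drop_nth x).
Qed.

Lemma cancel_step_cons2 (n : nat) (x y : bool * posroot n) (t : word n) :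
  cancel_step [:: x, y & t]
  = if ~~ x.1 && y.1 then t else x :: cancel_step (y :: t).
Proof. by []. Qed.

Lemma stacks_cancel_step (n : nat) (PM : seq (posroot n) * seq (posroot n))
    (s : word n) :
  stacks PM (cancel_step s) = stacks PM s.
Proof.
elim: s PM => [//|x [|y t] IH] PM //; rewrite cancel_step_cons2.
case: ifP => [/andP[xN yP]|_]; last exact: IH.
by rewrite /= /stack_step (negPf xN) yP /=; case: PM.
Qed.

Definition minus_last (T : Type) : rel (bool * T) := fun x y => x.1 || ~~ y.1.

Lemma minus_last_trans (T : Type) : transitive (@minus_last T).
Proof. by move=> [[] x] [[] y] [[] z]. Qed.

(** Either no factor -+ is left or the word shrinks, so [size s] steps bring [reduce] to its normal
    form. *)
Lemma size_cancel_step (n : nat) (s : word n) :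
  if sorted (@minus_last _) s then cancel_step s = s
  else size (cancel_step s) < size s.
Proof.
elim: s => [//|x [|y t] IH] //; rewrite cancel_step_cons2.
have -> : sorted (@minus_last _) [:: x, y & t]
  = (x.1 || ~~ y.1) && sorted (@minus_last _) (y :: t) by [].
move: (cancel_step (y :: t)) (sorted _ (y :: t)) IH => c b.
case: x.1; case: y.1 => //= IH; try by case: b IH => [->|]; rewrite //= ltnS.
Qed.

Lemma sorted_reduce (n : nat) (s : word n) : sorted (@minus_last _) (reduce s).
Proof.
rewrite /reduce; move: {-1}(size s) (leqnn (size s)) => m.
elim: m s => [|m IH] s le_m; first by case: s le_m.
rewrite iterSr; have := size_cancel_step s.
case: ifP => [s_sorted ->|_ lt_s]; last first.
  by apply: IH; rewrite -ltnS (leq_trans lt_s).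
have e : cancel_step s = s by have := size_cancel_step s; rewrite s_sorted.
by have -> : iter m (@cancel_step n) s = s by elim: m {le_m IH} => //= m ->.
Qed.

Lemma stacks_reduce (n : nat) (PM : seq (posroot n) * seq (posroot n))
    (s : word n) :
  stacks PM (reduce s) = stacks PM s.
Proof.
rewrite /reduce; elim: (size s) => [//|m IH] /=.
by rewrite stacks_cancel_step.
Qed.

Lemma stacks_sorted (n : nat) (s : word n) : sorted (@minus_last _) s ->
  stacks ([::], [::]) s = (rev (plus_roots s), rev (minus_roots s)).
Proof.
elim/last_ind: s => [//|s [b x] IH] s_sorted.
have {}IH : stacks ([::], [::]) s = _ := IH (subseq_sorted
  (@minus_last_trans _) (subseq_rcons _ _) s_sorted).
rewrite stacks_rcons IH /plus_roots /minus_roots !filter_rcons /=.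
case: b s_sorted => s_sorted; rewrite /stack_step /= map_rcons rev_rcons //.
suff -> : [seq y <- s | ~~ y.1] = [::] by [].
apply/eqP; rewrite -[_ == _]negbK -has_filter -all_predC; apply/allP => y ys /=.
move: s_sorted; rewrite sorted_pairwise; last exact: minus_last_trans.
rewrite pairwise_rcons => /andP[/allP/(_ y ys)]; rewrite /minus_last /=.
by rewrite orbF negbK.
Qed.

Lemma roots_reduce (n : nat) (s : word n) :
  stacks ([::], [::]) s
  = (rev (plus_roots (reduce s)), rev (minus_roots (reduce s))).
Proof. by rewrite -stacks_reduce stacks_sorted // sorted_reduce. Qed.

Definition tagged_word (n : nat) (i : 'I_n.-1) (A : kostant n) :
    seq (bool * (bool * posroot n)) :=
  [seq (x.1, (true, x.2)) | x <- dual_wordW i A]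
  ++ [seq (x.1, (false, x.2)) | x <- wordW i A].

Definition new_root (n : nat) (i : 'I_n.-1) (t : bool * posroot n) :
    'I_n * 'I_n :=
  if t.1 then (lo i, (val t.2).2) else ((val t.2).1, hi i).

(** Side by side the reduced words read +^a' -^b' +^a -^b. If b' < a, the rightmost surviving + is
    that of W_i; otherwise all + of W_i are cancelled and it is that of W_i^*. *)
Lemma f_op_stacks (n : nat) (i : 'I_n.-1) (A : kostant n) :
  f_op i A
  = obind (fun t => replace_root A t.2 (new_root i t))
      (ohead (stacks ([::], [::]) (tagged_word i A)).1).
Proof.
rewrite /tagged_word stacks_cat.
rewrite (stacks_map (pair true) [::] [::]) stacks_from /=.
rewrite (stacks_map (pair false) [::] [::]) /=.
rewrite !roots_reduce /= !size_map !size_rev /f_op /olast.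
set PV := plus_roots (reduce (dual_wordW i A)).
set MV := minus_roots (reduce (dual_wordW i A)).
set PW := plus_roots (reduce (wordW i A)).
case: (ltnP (size MV) (size PW)) => ltMP.
  have : 0 < size PW - size MV by rewrite subn_gt0.
  move: (size PW - size MV) => [//|d] _.
  by rewrite -(size_rev PW) in ltMP *; case: (rev PW) ltMP.
rewrite (_ : size PW - size MV = 0); last by apply/eqP; rewrite subn_eq0.
rewrite take0 cat0s -(size_rev PV); by case: (rev PV).
Qed.

(** * Multiplicities and weights *)

Notation key := (bool * nat)%type.

Definition key_word (g : key -> nat * nat) (ks : seq key) : seq (bool * key) :=
  flatten [seq nseq (g t).1 (true, t) ++ nseq (g t).2 (false, t) | t <- ks].

Lemma nseq_cat_cons (T : Type) (x : nat) (t : T) (P : seq T) :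
  nseq x t ++ t :: P = t :: nseq x t ++ P.
Proof. by elim: x => //= x ->. Qed.

Lemma stacks_nseq_plus (T : Type) (P M : seq T) (x : nat) (t : T) :
  stacks (P, M) (nseq x (true, t)) = (nseq (x - size M) t ++ P, drop x M).
Proof.
elim: x P M => [|x IH] P [|m M] //=; rewrite IH //= ?subn0 //.
by rewrite nseq_cat_cons.
Qed.

Lemma stacks_nseq_minus (T : Type) (P M : seq T) (y : nat) (t : T) :
  stacks (P, M) (nseq y (false, t)) = (P, nseq y t ++ M).
Proof.
elim: y M => [|y IH] M //=; rewrite IH.
by rewrite nseq_cat_cons.
Qed.

(** The reversal is due to [sig_eps] and [sig_loc] having the rightmost block at the head of the
    list. *)
Lemma stacks_key_word (g : key -> nat * nat) (ks : seq key) :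
  let PM := stacks ([::], [::]) (key_word g (rev ks)) in
  size PM.2 = sig_eps g 0 ks /\ ohead PM.1 = sig_loc g 0 ks.
Proof.
rewrite /key_word; elim: ks => [//|t ks] /=; rewrite rev_cons map_rcons.
rewrite flatten_rcons !stacks_cat; case: (stacks _ _) => P M /= [eM eP].
rewrite stacks_nseq_plus stacks_nseq_minus /=.
rewrite size_cat size_nseq size_drop eM; split => //.
rewrite -subn_gt0; case: (_ - _) => [|d] //=.
Qed.

Definition posnat (n : nat) (r : posroot n) : nat * nat :=
  (nat_of_ord (val r).1, nat_of_ord (val r).2).

Lemma posnat_inj (n : nat) : injective (@posnat n).
Proof.
move=> r s [e1 e2]; apply: val_inj.
by rewrite [LHS]surjective_pairing [RHS]surjective_pairing; congr (_, _);
  apply: val_inj.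
Qed.

(** Indexed by all pairs of naturals, with value 0 off the positive roots ([cnt_eq0]), so that
    blocks may mention pairs such as (i, i) freely. *)
Definition cnt (n : nat) (A : kostant n) (p : nat * nat) : nat :=
  count_mem p [seq posnat r | r <- A].

Lemma cnt_posnat (n : nat) (A : kostant n) (r : posroot n) :
  cnt A (posnat r) = A r.
Proof.
rewrite /cnt count_map -count_mem_mset; apply: eq_count => s /=.
exact: (inj_eq (@posnat_inj n)).
Qed.

Lemma cnt_inj (n : nat) (A B : kostant n) : cnt A =1 cnt B -> A = B.
Proof. by move=> eAB; apply/msetP => r; rewrite -!cnt_posnat. Qed.

Lemma cnt_eq0 (n : nat) (A : kostant n) (p : nat * nat) :
  ~~ (p.1 < p.2 < n) -> cnt A p = 0.
Proof.
move=> pN; apply/count_memPn; apply/mapP => -[r _ e]; move: pN.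
by rewrite e /= (valP r) ltn_ord.
Qed.

Definition plus_of (i : nat) (t : key) : nat * nat :=
  if t.1 then (i.+1, t.2) else (t.2, i).

Definition minus_of (i : nat) (t : key) : nat * nat :=
  if t.1 then (i, t.2) else (t.2, i.+1).

Definition blk (n : nat) (i : nat) (A : kostant n) (t : key) : nat * nat :=
  (cnt A (plus_of i t), cnt A (minus_of i t)).

(* The blocks of the word W_i^* W_i from right to left: (false, h) stands for *)
(* the roots starting at h, (true, j) for the roots ending at j.              *)
Definition keys (n : nat) : seq key :=
  [seq (false, h) | h <- iota 0 n] ++ [seq (true, j) | j <- rev (iota 0 n)].

Definition tag_key (n : nat) (t : bool * posroot n) : key :=
  if t.1 then (true, (posnat t.2).2) else (false, (posnat t.2).1).

(** * Sorted words of roots as words of blocks *)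

Lemma pairwise_pmap (S T : Type) (f : S -> option T) (r : rel S) (q : rel T)
    (s : seq S) :
  (forall x y c d, r x y -> f x = Some c -> f y = Some d -> q c d) ->
  pairwise r s -> pairwise q (pmap f s).
Proof.
move=> frq; elim: s => [//|x s IH] /= /andP[rx /IH]; case E: (f x) => //= [c].
move=> ->; rewrite andbT; elim: s rx {IH} => [//|y s IHs] /= /andP[rxy /IHs].
by case Ey: (f y) => [d|] //= ->; rewrite (frq x y).
Qed.

Lemma count_pmap (S : Type) (T : eqType) (f : S -> option T) (s : seq S)
    (c : T) :
  count_mem c (pmap f s) = count (fun x => f x == Some c) s.
Proof. by elim: s => [//|x s IH] /=; case: (f x) => [d|] //=; rewrite IH. Qed.

Lemma count_flatten_blocks (g : key -> nat * nat) (ks : seq key) (b : bool)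
    (t : key) : uniq ks ->
  count_mem (b, t) (key_word g ks)
  = if t \in ks then (if b then (g t).1 else (g t).2) else 0.
Proof.
rewrite /key_word; elim: ks => [//|u ks IH] /= /andP[uN /IH {}IH].
rewrite count_cat IH count_cat !count_nseq /= inE !xpair_eqE.
case: (eqVneq t u) => [->|] /=; last by rewrite !andbF.
by rewrite (negPf uN) !andbT; case: b {IH}; rewrite /= ?mul1n ?mul0n ?addn0.
Qed.

Definition key_le (lt : rel nat) : rel (bool * key) := fun x y =>
  lt x.2.2 y.2.2 || (x.2.2 == y.2.2) && (x.1 || ~~ y.1).

Lemma key_word_sorted (lt : rel nat) (g : key -> nat * nat) (d : bool)
    (hs : seq nat) : pairwise lt hs ->
  pairwise (key_le lt) (key_word g [seq (d, h) | h <- hs]).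
Proof.
elim: hs => [//|h hs IH] /andP[lt_h /IH {}IH].
rewrite /key_word [map _ (_ :: _)]/= [map _ (_ :: _)]/= [flatten _]/=.
rewrite pairwise_cat {}IH andbT; apply/andP; split.
  apply/allrelP => x y; rewrite mem_cat !mem_nseq => xh.
  move=> /flattenP[? /mapP[? /mapP[h' h'hs ->] ->]].
  rewrite mem_cat !mem_nseq => yh.
  have xE : x.2.2 = h by case/orP: xh => /andP[_ /eqP ->].
  have yE : y.2.2 = h' by case/orP: yh => /andP[_ /eqP ->].
  by rewrite /key_le xE yE (allP lt_h).
rewrite pairwise_cat; apply/and3P; split.
- apply/allrelP => x y; rewrite !mem_nseq => /andP[_ /eqP ->] /andP[_ /eqP ->].
  by rewrite /key_le /= eqxx orbT.
- elim: (_.1) => [//|m IHm] /=; rewrite IHm andbT all_nseq /key_le /=.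
  by rewrite eqxx !orbT.
elim: (_.2) => [//|m IHm] /=; rewrite IHm andbT all_nseq /key_le /=.
by rewrite eqxx !orbT.
Qed.

(** On keys of one kind the order is antisymmetric, so a multiset of symbols has only one sorted
    arrangement. *)
Lemma key_le_anti (lt : rel nat) (s s' : seq (bool * key)) (d : bool) :
  irreflexive lt -> transitive lt ->
  all (fun x => x.2.1 == d) s -> all (fun x => x.2.1 == d) s' ->
  pairwise (key_le lt) s -> pairwise (key_le lt) s' -> perm_eq s s' -> s = s'.
Proof.
move=> lt_irr lt_tr sd s'd.
have lt_asym x y : lt x y -> lt y x -> False.
  by move=> xy yx; have := lt_irr x; rewrite (lt_tr y).
have le_tr : transitive (key_le lt).
  move=> [b1 [d1 h1]] [b2 [d2 h2]] [b3 [d3 h3]]; rewrite /key_le /=.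
  case/orP => [lt21|/andP[/eqP -> le21]].
    case/orP => [/(lt_tr _ _ _ lt21) -> //|/andP[/eqP <- _]].
    by rewrite lt21.
  case/orP => [-> //|/andP[-> le13]]; rewrite /= orbC.
  by move: le21 le13; case: b1 b2 b3 => [] [] [].
rewrite -!sorted_pairwise //; apply: sorted_eq_in => //.
  by move=> x y z _ _ _; apply: le_tr.
move=> [b1 [d1 h1]] [b2 [d2 h2]] /(allP sd) /= /eqP -> /(allP sd) /= /eqP ->.
rewrite /key_le /=; case/andP => /orP[lt12|/andP[/eqP -> le12]].
  case/orP => [/lt_asym - /(_ lt12) //|/andP[/eqP e _]].
  by rewrite e lt_irr in lt12.
rewrite lt_irr eqxx /=; by case: b1 b2 le12 => [] [].
Qed.

Definition main_code (n : nat) (i : 'I_n.-1) (r : posroot n) :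
    option (bool * key) :=
  omap (fun x => (x.1, (false, (posnat x.2).1))) (mark i r).

Definition dual_code (n : nat) (i : 'I_n.-1) (r : posroot n) :
    option (bool * key) :=
  omap (fun x => (x.1, (true, (posnat x.2).2))) (dual_mark i r).

Lemma map_pmap (S T U : Type) (f : S -> option T) (g : T -> U) (s : seq S) :
  [seq g x | x <- pmap f s] = pmap (fun x => omap g (f x)) s.
Proof. by elim: s => [//|x s IH] /=; case: (f x) => //= y; rewrite IH. Qed.

Lemma tagged_word_keys (n : nat) (i : 'I_n.-1) (A : kostant n) :
  [seq (x.1, tag_key x.2) | x <- tagged_word i A]
  = pmap (dual_code i) (sort (@dual_word_order n) A)
    ++ pmap (main_code i) (sort (@word_order n) A).
Proof. by rewrite /tagged_word map_cat -!map_comp -!map_pmap. Qed.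

Lemma eq_Some (T : eqType) (x y : T) : (Some x == Some y) = (x == y).
Proof. by []. Qed.

Lemma eq_None_Some (T : eqType) (y : T) : (None == Some y) = false.
Proof. by []. Qed.

Lemma main_codeP (n : nat) (i : 'I_n.-1) (r : posroot n) (b : bool) (t : key) :
  (main_code i r == Some (b, t))
  = ~~ t.1 && (posnat r == if b then plus_of i t else minus_of i t).
Proof.
case: t => d h; rewrite /main_code /mark -!val_eqE /=.
move E : (posnat r) => [r1 r2]; case: E => e1 e2; rewrite e2.
rewrite /plus_of /minus_of /=.
case: (eqVneq r2 i) => [->|ne1] /=; last case: (eqVneq r2 i.+1) => [->|ne2] /=.
all: rewrite ?eq_Some ?eq_None_Some ?e1; case: d; case: b;
  rewrite ?xpair_eqE /=; lia.
Qed.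

Lemma dual_codeP (n : nat) (i : 'I_n.-1) (r : posroot n) (b : bool) (t : key) :
  (dual_code i r == Some (b, t))
  = t.1 && (posnat r == if b then plus_of i t else minus_of i t).
Proof.
case: t => d h; rewrite /dual_code /dual_mark -!val_eqE /=.
move E : (posnat r) => [r1 r2]; case: E => e1 e2; rewrite e1.
rewrite /plus_of /minus_of /=.
case: (eqVneq r1 i.+1) => [->|ne1] /=; last case: (eqVneq r1 i) => [->|ne2] /=.
all: rewrite ?eq_Some ?eq_None_Some ?e2; case: d; case: b;
  rewrite ?xpair_eqE /=; lia.
Qed.

Lemma main_code_le (n : nat) (i : 'I_n.-1) (r s : posroot n)
    (c d : bool * key) :
  word_order r s -> main_code i r = Some c -> main_code i s = Some d ->
  key_le gtn c d.
Proof.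
case: c d => [b [x h]] [b' [x' h']] rs /eqP; rewrite main_codeP => /andP[dx er].
move=> /eqP; rewrite main_codeP => /andP[dx' es]; move: rs er es.
rewrite /word_order -val_eqE /posnat /key_le /plus_of /minus_of /=.
move: (nat_of_ord (val r).1) (nat_of_ord (val r).2) => r1 r2.
move: (nat_of_ord (val s).1) (nat_of_ord (val s).2) => s1 s2.
by case: b; case: b'; case: x dx => //; case: x' dx' => // _ _;
  rewrite !xpair_eqE /=; lia.
Qed.

Lemma dual_code_le (n : nat) (i : 'I_n.-1) (r s : posroot n)
    (c d : bool * key) :
  dual_word_order r s -> dual_code i r = Some c -> dual_code i s = Some d ->
  key_le ltn c d.
Proof.
case: c d => [b [x h]] [b' [x' h']] rs /eqP; rewrite dual_codeP => /andP[dx er].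
move=> /eqP; rewrite dual_codeP => /andP[dx' es]; move: rs er es.
rewrite /dual_word_order -val_eqE /posnat /key_le /plus_of /minus_of /=.
move: (nat_of_ord (val r).1) (nat_of_ord (val r).2) => r1 r2.
move: (nat_of_ord (val s).1) (nat_of_ord (val s).2) => s1 s2.
by case: b; case: b'; case: x dx => //; case: x' dx' => // _ _;
  rewrite !xpair_eqE /=; lia.
Qed.

Lemma word_order_total (n : nat) : total (@word_order n).
Proof. by move=> r s; rewrite /word_order -!val_eqE /=; lia. Qed.

Lemma word_order_trans (n : nat) : transitive (@word_order n).
Proof. by move=> r s t; rewrite /word_order -!val_eqE /=; lia. Qed.

Lemma dual_word_order_total (n : nat) : total (@dual_word_order n).
Proof. by move=> r s; rewrite /dual_word_order -!val_eqE /=; lia. Qed.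

Lemma dual_word_order_trans (n : nat) : transitive (@dual_word_order n).
Proof. by move=> r s t; rewrite /dual_word_order -!val_eqE /=; lia. Qed.

(** Both sides are sorted and contain each coded symbol equally often. The starts h decrease from
    left to right, whence [rev]. *)
Lemma main_code_word (n : nat) (i : 'I_n.-1) (A : kostant n) :
  pmap (main_code i) (sort (@word_order n) A)
  = key_word (blk i A) [seq (false, h) | h <- rev (iota 0 n)].
Proof.
apply: (@key_le_anti gtn _ _ false).
- exact: ltnn.
- by move=> x y z /=; lia.
- apply/allP => x; rewrite mem_pmap => /mapP[r _ /esym/eqP].
  by case: x => [b t]; rewrite main_codeP; case: t => [[] h].
- by apply/allP => x /flattenP[? /mapP[? /mapP[h _ ->] ->]];
    rewrite mem_cat !mem_nseq => /orP[] /andP[_ /eqP ->].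
- apply: (pairwise_pmap (r := @word_order n)).
    by move=> r s c d; apply: main_code_le.
  rewrite -sorted_pairwise; last exact: word_order_trans.
  exact/sort_sorted/word_order_total.
- apply: key_word_sorted; rewrite -sorted_pairwise; last first.
    by move=> x y z /=; lia.
  by rewrite rev_sorted iota_ltn_sorted.
apply/allP => -[b t] _ /=; apply/eqP.
rewrite count_pmap count_flatten_blocks; last first.
  by rewrite map_inj_uniq ?rev_uniq ?iota_uniq // => x y [].
rewrite (seq.permP (permEl (perm_sort _ _))).
rewrite (eq_count (fun r => main_codeP i r b t)).
case: t => [[] h] /=; first by rewrite count_pred0; case: ifP => // /mapP[].
rewrite mem_map; last by move=> x y [].
rewrite mem_rev mem_iota /= add0n; case: ltnP => le_h.
  by case: b; rewrite /blk /cnt count_map /=; apply: eq_count.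
apply/eqP; rewrite eqn0Ngt -has_count; apply/hasPn => r _.
rewrite /posnat /plus_of /minus_of; have := ltn_ord (val r).1.
by case: b; rewrite /= xpair_eqE; lia.
Qed.

Lemma dual_code_word (n : nat) (i : 'I_n.-1) (A : kostant n) :
  pmap (dual_code i) (sort (@dual_word_order n) A)
  = key_word (blk i A) [seq (true, j) | j <- iota 0 n].
Proof.
apply: (@key_le_anti ltn _ _ true).
- exact: ltnn.
- by move=> x y z /=; lia.
- apply/allP => x; rewrite mem_pmap => /mapP[r _ /esym/eqP].
  by case: x => [b t]; rewrite dual_codeP; case: t => [[] h].
- by apply/allP => x /flattenP[? /mapP[? /mapP[h _ ->] ->]];
    rewrite mem_cat !mem_nseq => /orP[] /andP[_ /eqP ->].
- apply: (pairwise_pmap (r := @dual_word_order n)).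
    by move=> r s c d; apply: dual_code_le.
  rewrite -sorted_pairwise; last exact: dual_word_order_trans.
  exact/sort_sorted/dual_word_order_total.
- apply: key_word_sorted; rewrite -sorted_pairwise; last first.
    by move=> x y z /=; lia.
  by rewrite iota_ltn_sorted.
apply/allP => -[b t] _ /=; apply/eqP.
rewrite count_pmap count_flatten_blocks; last first.
  by rewrite map_inj_uniq ?iota_uniq // => x y [].
rewrite (seq.permP (permEl (perm_sort _ _))).
rewrite (eq_count (fun r => dual_codeP i r b t)).
case: t => [[] h] /=; last by rewrite count_pred0; case: ifP => // /mapP[].
rewrite mem_map; last by move=> x y [].
rewrite mem_iota /= add0n; case: ltnP => le_h.
  by case: b; rewrite /blk /cnt count_map /=; apply: eq_count.
apply/eqP; rewrite eqn0Ngt -has_count; apply/hasPn => r _.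
rewrite /posnat /plus_of /minus_of; have := ltn_ord (val r).2.
by case: b; rewrite /= xpair_eqE; lia.
Qed.

Lemma tagged_word_key_word (n : nat) (i : 'I_n.-1) (A : kostant n) :
  [seq (x.1, tag_key x.2) | x <- tagged_word i A]
  = key_word (blk i A) (rev (keys n)).
Proof.
rewrite tagged_word_keys main_code_word dual_code_word.
by rewrite /keys rev_cat /key_word map_cat flatten_cat -!map_rev revK.
Qed.

Lemma stacks_sub (T : eqType) (s : seq (bool * T)) (x : T) :
  x \in (stacks ([::], [::]) s).1 -> (true, x) \in s.
Proof.
elim/last_ind: s => [//|s [b y] IH]; rewrite stacks_rcons mem_rcons inE.
case: (stacks _ s) IH => P M; rewrite /stack_step /= => IH.
case: b; [case: M IH => [|m M] IH|]; rewrite /= ?inE.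
- by case/orP => [/eqP ->|/IH ->]; rewrite ?eqxx ?orbT.
- by move/IH ->; rewrite ?orbT.
by move/IH ->; rewrite ?orbT.
Qed.

Lemma mem_tagged_word (n : nat) (i : 'I_n.-1) (A : kostant n) (d : bool)
    (r : posroot n) :
  (true, (d, r)) \in tagged_word i A ->
  r \in A /\ posnat r = plus_of i (tag_key (d, r)).
Proof.
rewrite mem_cat => /orP[] /mapP[[b s]]; rewrite mem_pmap => /mapP[s'].
  rewrite mem_sort => s'A /esym; rewrite /dual_mark.
  case: eqP => [e [<- <-] [-> ->]|_]; last by case: ifP => // _ [<- <-] [].
  by split=> //; rewrite /posnat /plus_of /tag_key /= e.
rewrite mem_sort => s'A /esym; rewrite /mark.
case: eqP => [e [<- <-] [-> ->]|_]; last by case: ifP => // _ [<- <-] [].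
by split=> //; rewrite /posnat /plus_of /tag_key /= e.
Qed.

Lemma perm_replace (n : nat) (A : kostant n) (r q : posroot n) :
  r \in A -> perm_eq (r :: (q +` (A `\ r))%mset) (q :: A).
Proof.
rewrite in_mset => rA; apply/allP => s _ /=.
rewrite !count_mem_mset mset1DE msetB1E ![s == _]eq_sym.
by apply/eqP; case: (eqVneq r s) => [<-|_]; lia.
Qed.

(** The exchange of one root for another is stated by adding a root on each side, which avoids
    subtracting multiplicities. *)
Lemma f_op_loc (n : nat) (i : 'I_n.-1) (A : kostant n) :
  match sig_loc (blk i A) 0 (keys n) with
  | None => f_op i A = None
  | Some t => exists A' : kostant n, f_op i A = Some A' /\
      perm_eq (plus_of i t :: [seq posnat r | r <- A'])
              (minus_of i t :: [seq posnat r | r <- A])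
  end.
Proof.
have [_ <-] := stacks_key_word (blk i A) (keys n).
rewrite -tagged_word_key_word (stacks_map (@tag_key n) [::] [::]) f_op_stacks.
have sub_tw := @stacks_sub _ (tagged_word i A).
case: (stacks _ _).1 sub_tw => [//|[d r] P] /(_ _ (mem_head _ _)) /= rtw.
have [rA er] := mem_tagged_word rtw.
rewrite /replace_root.
(* The new pair is again a positive root, so [insub] succeeds. *)
have lt_new : (new_root i (d, r)).1 < (new_root i (d, r)).2.
  move: (valP r) er; rewrite /new_root /posnat /plus_of /tag_key /=.
  by case: (d) => /= + [] => /[swap] e1; rewrite /posnat /=; lia.
rewrite (insubT (fun r : 'I_n * 'I_n => (r.1 < r.2)%N) lt_new) /=.
eexists; split; first by [].
have -> : minus_of i (tag_key (d, r)) = posnat (Sub (new_root i (d, r)) lt_new).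
  rewrite [RHS]/posnat SubK.
  rewrite /new_root /posnat /plus_of /minus_of /tag_key /=.
  by case: (d).
by rewrite -er -!map_cons; apply/perm_map/perm_replace.
Qed.

Lemma cnt_f_op (n : nat) (i : nat) (A A' : kostant n) (t : key) :
  perm_eq (plus_of i t :: [seq posnat r | r <- A'])
          (minus_of i t :: [seq posnat r | r <- A]) ->
  forall p, cnt A' p + (p == plus_of i t) = cnt A p + (p == minus_of i t).
Proof.
move=> /seq.permP eAA' p; have := eAA' (pred1 p).
by rewrite /= ![_ == p]eq_sym addnC [RHS]addnC.
Qed.

(** * Weights and the numbers of signs *)

Lemma sig_sum1E (T : Type) (g : T -> nat * nat) (s : seq T) :
  sig_sum1 g s = \sum_(t <- s) (g t).1.
Proof. by elim: s => [|t s /= ->]; rewrite ?big_nil ?big_cons. Qed.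

Lemma sig_sum2E (T : Type) (g : T -> nat * nat) (s : seq T) :
  sig_sum2 g s = \sum_(t <- s) (g t).2.
Proof. by elim: s => [|t s /= ->]; rewrite ?big_nil ?big_cons. Qed.

Lemma sum_cnt (n : nat) (A : kostant n) (f : key -> nat * nat) :
  \sum_(t <- keys n) cnt A (f t)
  = \sum_(r <- A) \sum_(t <- keys n) (posnat r == f t).
Proof.
rewrite exchange_big; apply: eq_bigr => t _.
rewrite /cnt -sum1_count big_map big_mkcond; apply: eq_bigr => r _ /=.
by case: (_ == _).
Qed.

Lemma sum_eq_iota (n x : nat) : \sum_(h <- iota 0 n) (x == h) = (x < n).
Proof.
elim: n => [|n IH]; first by rewrite big_nil.
by rewrite -addn1 iotaD big_cat IH big_cons big_nil /=; lia.
Qed.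

Lemma sum_keys (n : nat) (f : key -> nat) :
  \sum_(t <- keys n) f t
  = \sum_(h <- iota 0 n) f (false, h) + \sum_(h <- iota 0 n) f (true, h).
Proof.
by rewrite /keys big_cat !big_map (perm_big _ (permEl (perm_rev _))).
Qed.

Lemma sum_keys_plus (n i : nat) (r : posroot n) :
  \sum_(t <- keys n) (posnat r == plus_of i t)
  = ((posnat r).2 == i) + ((posnat r).1 == i.+1).
Proof.
rewrite /posnat; have := ltn_ord (val r).2; have := ltn_ord (val r).1.
move: (nat_of_ord (val r).1) (nat_of_ord (val r).2) => r1 r2 l1 l2.
rewrite sum_keys /plus_of /=.
under eq_bigr do rewrite xpair_eqE -mulnb.
under [X in _ + X]eq_bigr do rewrite xpair_eqE -mulnb.
by rewrite -big_distrl -big_distrr /= !sum_eq_iota l1 l2 mul1n muln1.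
Qed.

Lemma sum_keys_minus (n i : nat) (r : posroot n) :
  \sum_(t <- keys n) (posnat r == minus_of i t)
  = ((posnat r).2 == i.+1) + ((posnat r).1 == i).
Proof.
rewrite /posnat; have := ltn_ord (val r).2; have := ltn_ord (val r).1.
move: (nat_of_ord (val r).1) (nat_of_ord (val r).2) => r1 r2 l1 l2.
rewrite sum_keys /minus_of /=.
under eq_bigr do rewrite xpair_eqE -mulnb.
under [X in _ + X]eq_bigr do rewrite xpair_eqE -mulnb.
by rewrite -big_distrl -big_distrr /= !sum_eq_iota l1 l2 mul1n muln1.
Qed.

Local Open Scope ring_scope.

(** Contribution of a root to W_i^* W_i, equal to minus its pairing with the i-th simple coroot; (i,
    i+1) counts -2, once from each word. *)
Definition charge (i : nat) (p : nat * nat) : int :=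
  (p.2 == i)%:Z + (p.1 == i.+1)%:Z - (p.2 == i.+1)%:Z - (p.1 == i)%:Z.

Definition weight_of (n : nat) (i : nat) (A : kostant n) : int :=
  \sum_(p <- [seq posnat r | r <- A]) charge i p.

Lemma weight_of_sums (n i : nat) (A : kostant n) :
  (sig_sum1 (blk i A) (keys n))%:Z
  = weight_of i A + (sig_sum2 (blk i A) (keys n))%:Z.
Proof.
rewrite sig_sum1E sig_sum2E /blk /= !sum_cnt /weight_of big_map.
elim: (enum_mset A) => [|r s IH]; first by rewrite !big_nil.
rewrite !big_cons /= sum_keys_plus sum_keys_minus !PoszD IH.
move: (\sum_(_ <- s) charge _ _) (\sum_(_ <- s) _)%N => S1 S2.
rewrite /charge; lia.
Qed.

Lemma weight_of_f_op (n : nat) (i j : nat) (A A' : kostant n) (t : key) :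
  perm_eq (plus_of j t :: [seq posnat r | r <- A'])
          (minus_of j t :: [seq posnat r | r <- A]) ->
  weight_of i A'
  = weight_of i A + (i.+1 == j)%:Z + (i == j.+1)%:Z - ((i == j) + (i == j))%:Z.
Proof.
move=> eAA'.
have : charge i (plus_of j t) + weight_of i A'
     = charge i (minus_of j t) + weight_of i A.
  have -> : charge i (plus_of j t) + weight_of i A'
      = \sum_(p <- plus_of j t :: [seq posnat r | r <- A']) charge i p.
    by rewrite big_cons.
  by rewrite (perm_big _ eAA') big_cons.
by rewrite /charge /plus_of /minus_of; case: t {eAA'} => [[] h] /=; lia.
Qed.

Lemma pairingD (n : nat) (x y : weight n) (i : 'I_n.-1) :
  pairing (x + y) i = pairing x i + pairing y i.
Proof.
rewrite -[x]reprK -[y]reprK -raddfD !pairing_pi !mxE.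
by rewrite opprD addrACA.
Qed.

Lemma pairing_kostant_weight (n : nat) (A : kostant n) (i : 'I_n.-1) :
  pairing (kostant_weight A) i = - weight_of i A.
Proof.
have pairingN (x : weight n) : pairing (- x) i = - pairing x i.
  by rewrite -[x]reprK -raddfN !pairing_pi !mxE opprD.
have pairing0 : pairing (0 : weight n) i = 0.
  by have := pairingD 0 0 i; rewrite addr0; lia.
rewrite /kostant_weight /weight_of big_map.
elim: (enum_mset A) => [|r s IH]; first by rewrite !big_nil oppr0.
rewrite !big_cons [RHS]opprD pairingD IH pairingD pairingN !pairing_pi !mxE.
congr (_ + _); rewrite /charge /posnat /= -!val_eqE /=.
move: (nat_of_ord (val r).1) (nat_of_ord (val r).2) => r1 r2.
lia.
Qed.

Local Close Scope ring_scope.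

(** * Commutation of distant operators *)

Lemma sig_eps_cat (T : Type) (g : T -> nat * nat) (e : nat) (s1 s2 : seq T) :
  sig_eps g e (s1 ++ s2) = sig_eps g (sig_eps g e s2) s1.
Proof. by elim: s1 => [|t s IH] //=; rewrite IH. Qed.

Lemma sig_loc_cat (T : Type) (g : T -> nat * nat) (e : nat) (s1 s2 : seq T) :
  sig_loc g e (s1 ++ s2)
  = if sig_loc g (sig_eps g e s2) s1 is Some t then Some t else sig_loc g e s2.
Proof. by elim: s1 => [|t s IH] //=; rewrite sig_eps_cat; case: ifP. Qed.

Lemma eq_in_sig_eps (T : eqType) (g g' : T -> nat * nat) (e : nat)
    (s : seq T) :
  {in s, g =1 g'} -> sig_eps g e s = sig_eps g' e s.
Proof.
elim: s => [//|t s IH] gg' /=; rewrite IH ?gg' ?mem_head // => u us.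
by rewrite gg' // inE us orbT.
Qed.

Lemma eq_in_sig_phi (T : eqType) (g g' : T -> nat * nat) (e : nat)
    (s : seq T) :
  {in s, g =1 g'} -> sig_phi g e s = sig_phi g' e s.
Proof.
elim: s => [//|t s IH] gg' /=.
have gg's : {in s, g =1 g'} by move=> u us; rewrite gg' // inE us orbT.
by rewrite IH // (eq_in_sig_eps _ gg's) gg' ?mem_head.
Qed.

Lemma eq_in_sig_loc (T : eqType) (g g' : T -> nat * nat) (e : nat)
    (s : seq T) :
  {in s, g =1 g'} -> sig_loc g e s = sig_loc g' e s.
Proof.
elim: s => [//|t s IH] gg' /=.
have gg's : {in s, g =1 g'} by move=> u us; rewrite gg' // inE us orbT.
by rewrite IH // (eq_in_sig_eps _ gg's) gg' ?mem_head.
Qed.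

Lemma sig_loc_mem (T : eqType) (g : T -> nat * nat) (e : nat) (s : seq T)
    (t : T) :
  sig_loc g e s = Some t -> t \in s /\ 0 < (g t).1.
Proof.
elim: s => [//|u s IH] /=; case: ifP => [lt_eps [<-]|_ /IH[ts ?]].
  by rewrite mem_head (leq_ltn_trans _ lt_eps).
by rewrite inE ts orbT.
Qed.

Lemma sig_loc_none (T : Type) (g : T -> nat * nat) (e : nat) (s : seq T) :
  sig_loc g e s = None -> sig_phi g e s = 0.
Proof.
elim: s => [//|t s IH] /=; case: ltnP => // le_eps /IH ->.
by apply/eqP; rewrite subn_eq0.
Qed.

(** In the reduced word +^phi -^eps the last + becomes a -. *)
Lemma sig_phi_update (T : eqType) (g g' : T -> nat * nat) (e : nat)
    (s : seq T) (t : T) :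
  uniq s -> sig_loc g e s = Some t ->
  {in s, forall u, u != t -> g' u = g u} ->
  g' t = ((g t).1.-1, (g t).2.+1) ->
  sig_phi g e s = (sig_phi g' e s).+1
  /\ sig_eps g' e s = (sig_eps g e s).+1.
Proof.
move=> + + + gt; elim: s => [//|u s IH] /= /andP[us s_uniq] + gg'.
have gg's : {in s, forall v, v != t -> g' v = g v}.
  by move=> v vs; apply: gg'; rewrite inE vs orbT.
case: ltnP => [lt_eps [ut]|le_eps /[dup] /sig_loc_mem[ts _] /IH].
  subst u; rewrite gt; have gg'e : {in s, g' =1 g}.
    by move=> v vs; apply: gg's => //; apply: contraNneq us => <-.
  by rewrite (eq_in_sig_phi _ gg'e) (eq_in_sig_eps _ gg'e) /=; split; lia.
case=> // -> ->; rewrite gg' ?mem_head //; first by split; lia.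
by apply: contraNneq us => ->.
Qed.

Lemma keys_uniq (n : nat) : uniq (keys n).
Proof.
rewrite cat_uniq !map_inj_uniq ?rev_uniq ?iota_uniq ?andbT //=;
  try by move=> x y [].
by apply/hasPn => x /mapP[h _ ->]; apply/mapP => -[].
Qed.

Lemma mem_keys (n : nat) (t : key) : (t \in keys n) = (t.2 < n).
Proof.
rewrite mem_cat map_rev mem_rev; case: t => [[] h] /=.
  rewrite (mem_map (f := pair true)); last by move=> x y [].
  by rewrite mem_iota orb_idl // => /mapP[].
rewrite (mem_map (f := pair false)); last by move=> x y [].
by rewrite mem_iota orb_idr // => /mapP[].
Qed.

Definition f_move (n : nat) (i : nat) (A A' : kostant n) (t : key) : Prop :=
  sig_loc (blk i A) 0 (keys n) = Some t
  /\ perm_eq (plus_of i t :: [seq posnat r | r <- A'])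
             (minus_of i t :: [seq posnat r | r <- A]).

Lemma f_opP (n : nat) (i : 'I_n.-1) (A A' : kostant n) :
  f_op i A = Some A' -> exists t, f_move i A A' t.
Proof.
move=> fA; have := f_op_loc i A; case E: sig_loc => [t|]; last by rewrite fA.
by case=> A1 []; rewrite fA => -[<-]; exists t.
Qed.

Lemma f_op_some (n : nat) (i : 'I_n.-1) (A : kostant n) (t : key) :
  sig_loc (blk i A) 0 (keys n) = Some t ->
  exists A', f_op i A = Some A' /\ f_move i A A' t.
Proof.
by move=> E; have := f_op_loc i A; rewrite E => -[A' [fA AA']]; exists A'.
Qed.

(* The moved root is neither on nor just above the diagonal, so that its     *)
(* block determines it.                                                      *)
Lemma f_move_bounds (n : nat) (i : nat) (A A' : kostant n) (t : key) :
  f_move i A A' t -> 0 < cnt A (plus_of i t) /\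
  (if t.1 then i.+1 < t.2 < n else t.2 < i).
Proof.
case=> /sig_loc_mem[_ gt0] _; split=> //; move: gt0; rewrite /blk /=.
apply: contraTT => tN; rewrite cnt_eq0 //; move: tN; rewrite /plus_of.
by case: t => [[] h] //=; lia.
Qed.

Lemma f_move_cnt (n : nat) (i : nat) (A A' : kostant n) (t : key) :
  f_move i A A' t ->
  forall p, cnt A' p + (p == plus_of i t) = cnt A p + (p == minus_of i t).
Proof. by case=> _; apply: cnt_f_op. Qed.

(** The only root lying in two blocks is (i, i+1), which the bounds on [t] exclude. *)
Lemma f_move_blk (n : nat) (i : nat) (A A' : kostant n) (t : key) :
  f_move i A A' t ->
  blk i A' t = ((blk i A t).1.-1, (blk i A t).2.+1)
  /\ forall u, u != t -> blk i A' u = blk i A u.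
Proof.
move=> AA'; have [_ t_lt] := f_move_bounds AA'.
have e := f_move_cnt AA'; split.
  have := e (plus_of i t); have := e (minus_of i t); rewrite !eqxx.
  rewrite [minus_of i t == plus_of i t]eq_sym.
  have -> : (plus_of i t == minus_of i t) = false.
    by rewrite /plus_of /minus_of; case: (t.1); rewrite xpair_eqE; lia.
  by rewrite /blk /= => ? ?; congr (_, _); lia.
move=> u ut.
have neq p : p = plus_of i u \/ p = minus_of i u ->
    (cnt A p != 0) || (cnt A' p != 0) ->
    (p == plus_of i t) = false /\ (p == minus_of i t) = false.
  move=> pE /orP nz; have p_lt : p.1 < p.2 < n.
    by case: nz; apply: contraNT => /cnt_eq0 ->.
  move: pE p_lt ut t_lt {AA' e}; rewrite /plus_of /minus_of.
  case: u t => [d x] [d' y].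
  by case: d; case: d'; case=> -> /=; rewrite !xpair_eqE /=; lia.
have same p : p = plus_of i u \/ p = minus_of i u -> cnt A' p = cnt A p.
  move=> pE; case: (boolP ((cnt A p != 0) || (cnt A' p != 0))) => [nz|].
    by have := e p; have [-> ->] := neq p pE nz; rewrite !addn0.
  by rewrite negb_or !negbK => /andP[/eqP -> /eqP ->].
by rewrite /blk !same; [| right | left].
Qed.

Definition f_phi (n : nat) (i : nat) (A : kostant n) : nat :=
  sig_phi (blk i A) 0 (keys n).

Lemma f_move_phi (n : nat) (i : nat) (A A' : kostant n) (t : key) :
  f_move i A A' t -> f_phi i A = (f_phi i A').+1.
Proof.
move=> AA'; have [e1 e2] := f_move_blk AA'; case: (AA') => E _.
rewrite /f_phi; have [|-> _ //] := sig_phi_update (keys_uniq n) E _ e1.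
by move=> u _; apply: e2.
Qed.

Lemma weight_le_phi (n : nat) (i : nat) (A : kostant n) (m : nat) :
  (m%:Z <= weight_of i A)%R -> m <= f_phi i A.
Proof.
have := weight_of_sums i A; have := sig_phi_eps (blk i A) 0 (keys n).
by rewrite /f_phi; lia.
Qed.

Lemma opow_f_op (n : nat) (i : 'I_n.-1) (A : kostant n) (m : nat) :
  m <= f_phi i A -> exists A', [/\ opow (f_op i) m A = Some A',
    f_phi i A = f_phi i A' + m &
    forall j : nat, weight_of j A'
      = (weight_of j A + ((j.+1 == i) + (j == i.+1))%N%:Z * m%:Z
         - ((j == i) + (j == i))%N%:Z * m%:Z)%R].
Proof.
elim: m => [|m IH] le_m.
  by exists A; split; rewrite ?addn0 // => j; rewrite !mulr0 addr0 subr0.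
have [A1 [E1 e1 w1]] := IH (ltnW le_m).
case E: (sig_loc (blk i A1) 0 (keys n)) => [t|]; last first.
  by have := sig_loc_none E; rewrite -/(f_phi i A1); lia.
have [A2 [E2 AA2]] := f_op_some E; exists A2; split.
- by rewrite /opow iterS -/(opow _ _ _) E1.
- by rewrite e1 (f_move_phi AA2); lia.
move=> j; case: AA2 => _ /(weight_of_f_op j) ->; rewrite w1.
by case: eqVneq; case: eqVneq; case: eqVneq; lia.
Qed.

Lemma opow_obind (T : Type) (f : T -> option T) (m : nat) (x : T) :
  opow f m.+1 x = obind (opow f m) (f x).
Proof.
rewrite /opow iterSr /=; case: (f x) => [y|] //=.
by elim: m => [|m IH] //=; rewrite IH.
Qed.

(** One-step diamonds tile a rectangle of a by b steps. *)
Lemma opow_comm (T : Type) (f g : T -> option T) :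
  (forall x y z, f x = Some y -> g x = Some z ->
    exists w, g y = Some w /\ f z = Some w) ->
  forall (a b : nat) (x y z : T), opow f a x = Some y -> opow g b x = Some z ->
    exists w, opow g b y = Some w /\ opow f a z = Some w.
Proof.
move=> comm.
have comm1 b x y z : f x = Some y -> opow g b x = Some z ->
    exists w, opow g b y = Some w /\ f z = Some w.
  elim: b x y z => [|b IH] x y z fx; first by case=> <-; exists y.
  rewrite opow_obind; case gx: (g x) => [x1|] // gz.
  have [w1 [gy fx1]] := comm _ _ _ fx gx.
  have [w [gw fw]] := IH _ _ _ fx1 gz.
  by exists w; rewrite opow_obind gy.
elim=> [|a IH] b x y z; first by case=> <- gz; exists z.
rewrite opow_obind; case fx: (f x) => [x1|] // fy gz.
have [w1 [gx1 fz]] := comm1 _ _ _ _ fx gz.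
have [w [gw fw]] := IH _ _ _ _ fy gx1.
by exists w; rewrite opow_obind fz.
Qed.

Lemma uniq_pair_neq (T : eqType) (K1 K2 : seq T) (p q v : T) :
  uniq (K1 ++ [:: p; q] ++ K2) -> v \in K1 ++ K2 -> v != p /\ v != q.
Proof.
rewrite !cat_uniq mem_cat => /and3P[_ pqK1 /and3P[_ /hasPn pqK2 _]].
case/orP => [vK1|/pqK2]; last by rewrite !inE negb_or => /andP[].
move: pqK1; rewrite /= !negb_or => /and3P[pK1 qK1 _].
by split; apply: contraTneq vK1 => ->.
Qed.

(** The block [q] stands immediately to the left of [p], so its - cancel first against the + of
    [p]. *)
Lemma sig_loc_pair (T : eqType) (g : T -> nat * nat) (e : nat)
    (K1 K2 : seq T) (p q u : T) :
  uniq (K1 ++ [:: p; q] ++ K2) ->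
  sig_loc g e (K1 ++ [:: p; q] ++ K2) = Some u ->
  (u = p -> (g q).2 < (g p).1) /\
  (u = q -> (g p).1 <= (g q).2 /\ 0 < (g q).1).
Proof.
rewrite !sig_loc_cat !cat_uniq /= !inE !negb_or.
case/and3P=> _ /and3P[pK1 qK1 _] /and3P[/andP[pq _] /hasPn pqK2 _].
case E1: sig_loc => [v|].
  case=> <-; have [vK1 _] := sig_loc_mem E1.
  by split=> e1; move: vK1; rewrite e1 ?(negPf pK1) ?(negPf qK1).
case: ltnP => [lt_p [<-]|le_p].
  by split=> [_|e1]; [lia | rewrite e1 eqxx in pq].
case: ltnP => [lt_q [<-]|le_q E2].
  by split=> [e1|_]; [rewrite e1 eqxx in pq | lia].
have [uK2 _] := sig_loc_mem E2.
by split=> e1; move: uK2 => /pqK2; rewrite e1 !inE eqxx ?orbT.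
Qed.

(** Around the pair the word is +^q1 -^q2 +^p1 -^p2. Carrying a + from [q] to [p] when q2 <= p1, or
    a - when p1 < q2, does not change the reduced numbers of signs. The rightmost uncancelled +
    changes block only if it was in [q] and p1 = q2: the carried + then makes [p] the chosen
    block. *)
Lemma sig_loc_pair_move (T : eqType) (g g' : T -> nat * nat) (e : nat)
    (K1 K2 : seq T) (p q u : T) :
  uniq (K1 ++ [:: p; q] ++ K2) ->
  {in K1 ++ K2, g' =1 g} ->
  sig_loc g e (K1 ++ [:: p; q] ++ K2) = Some u ->
  [\/ [/\ g' q = g q & g' p = g p],
      [/\ 0 < (g q).1, (g q).2 <= (g p).1,
        g' q = ((g q).1.-1, (g q).2) & g' p = ((g p).1.+1, (g p).2)]
    | [/\ (g p).1 < (g q).2,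
        g' q = ((g q).1, (g q).2.-1) & g' p = ((g p).1, (g p).2.+1)]] ->
  exists u', sig_loc g' e (K1 ++ [:: p; q] ++ K2) = Some u'
    /\ (u' = u \/ [/\ u = q, u' = p, g' q = ((g q).1.-1, (g q).2) &
                     (g p).1 = (g q).2]).
Proof.
move=> uK g'g uE gpq; have gg' : {in K1, g =1 g'} /\ {in K2, g =1 g'}.
  by split=> v vK; rewrite g'g // mem_cat vK ?orbT.
have eps_pq e1 : sig_eps g' e1 [:: p; q] = sig_eps g e1 [:: p; q].
  by rewrite /=; case: gpq => [[-> ->]|[? ? -> ->]|[? -> ->]] //=; lia.
move: uE; rewrite !sig_loc_cat !sig_eps_cat eps_pq.
rewrite -(eq_in_sig_loc _ gg'.1) -!(eq_in_sig_loc _ gg'.2).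
rewrite -!(eq_in_sig_eps _ gg'.2).
case: (sig_loc g _ K1) => [v|]; first by case=> <-; exists v; split=> //; left.
move: (sig_eps g e K2) (sig_loc g e K2) => e2 l2 /=.
case: gpq => [[-> ->] E2|[gq0 lepq eq ep]|[ltpq -> ->]] /=.
- by exists u; split=> //; left.
- rewrite eq ep /=; case: ltnP => [lt_p [<-]|le_p].
    by exists p; split; [rewrite ifT //; lia | left].
  case: ltnP => [lt_q [<-]|le_q ->].
    case: (ltnP _ (g p).1.+1) => lt_p'.
      by exists p; split=> //; right; split=> //; lia.
    by exists q; split; [rewrite ifT //; lia | left].
  by exists u; rewrite !ifF; [split=> //; left | lia | lia].
rewrite ifF; last lia.
move=> uE; exists u; split; last by left.
by rewrite ifF; last lia.
Qed.

Lemma iota_pair (n i : nat) : i.+1 < n ->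
  iota 0 n = iota 0 i ++ [:: i; i.+1] ++ iota i.+2 (n - i.+2).
Proof.
move=> lt_i; rewrite -{1}(subnKC lt_i) iotaD add0n -{1}addn2 iotaD add0n.
by rewrite -catA.
Qed.

Lemma keys_rows (n i : nat) : i.+1 < n ->
  keys n = [seq (false, h) | h <- iota 0 i]
    ++ [:: (false, i); (false, i.+1)]
    ++ ([seq (false, h) | h <- iota i.+2 (n - i.+2)]
        ++ [seq (true, j) | j <- rev (iota 0 n)]).
Proof. by move=> lt_i; rewrite /keys {1}(iota_pair lt_i) !map_cat -!catA. Qed.

Lemma keys_cols (n i : nat) : i.+1 < n ->
  keys n = ([seq (false, h) | h <- iota 0 n]
        ++ [seq (true, j) | j <- rev (iota i.+2 (n - i.+2))])
    ++ [:: (true, i.+1); (true, i)] ++ [seq (true, j) | j <- rev (iota 0 i)].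
Proof.
move=> lt_i; rewrite /keys {2}(iota_pair lt_i) !rev_cat !map_cat -!catA.
by [].
Qed.

Lemma sig_loc_row (n i j : nat) (A : kostant n) (u : key) : i.+1 < n ->
  sig_loc (blk j A) 0 (keys n) = Some u ->
  (u = (false, i) -> cnt A (i.+1, j.+1) < cnt A (i, j))
  /\ (u = (false, i.+1) -> cnt A (i, j) <= cnt A (i.+1, j.+1)
                        /\ 0 < cnt A (i.+1, j)).
Proof.
move=> lt_i uE; move: uE (keys_uniq n); rewrite (keys_rows lt_i) => + uK.
exact: sig_loc_pair.
Qed.

Lemma sig_loc_col (n i j : nat) (A : kostant n) (t : key) : j.+1 < n ->
  sig_loc (blk i A) 0 (keys n) = Some t ->
  (t = (true, j.+1) -> cnt A (i, j) < cnt A (i.+1, j.+1))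
  /\ (t = (true, j) -> cnt A (i.+1, j.+1) <= cnt A (i, j)
                    /\ 0 < cnt A (i.+1, j)).
Proof.
move=> lt_j tE; move: tE (keys_uniq n); rewrite (keys_cols lt_j) => + uK.
exact: sig_loc_pair.
Qed.

(** Only [t = (true, j)] and [t = (true, j.+1)] affect W_j^* W_j: they carry a + or a - from row i+1
    to the adjacent row i. The inequality required by [sig_loc_pair_move] holds because f_i chose
    that column ([sig_loc_col]). *)
Lemma f_move_pair (n i j : nat) (A A1 A2 : kostant n) (t u : key) :
  i.+1 < j -> j.+1 < n -> f_move i A A1 t -> f_move j A A2 u ->
  exists u', sig_loc (blk j A1) 0 (keys n) = Some u'
    /\ (u' = u \/ [/\ t = (true, j), u = (false, i.+1) & u' = (false, i)]).
Proof.
move=> lt_ij lt_j AA1 AA2; have lt_i : i.+1 < n by lia.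
have [tpos t_lt] := f_move_bounds AA1; have cA := f_move_cnt AA1.
have [uE _] := AA2; have [tE _] := AA1.
have uK : uniq (keys n) := keys_uniq n.
have tQ := sig_loc_col lt_j tE.
have off v : v != (false, i) -> v != (false, i.+1) ->
    blk j A1 v = blk j A v.
  move=> vp vq; have := cA (plus_of j v); have := cA (minus_of j v).
  rewrite /blk /plus_of /minus_of; move: vp vq t_lt.
  by case: v t {AA1 tE tQ cA tpos} => [[] x] [[] y] /=; rewrite !xpair_eqE /=;
    move=> *; congr (_, _); lia.
rewrite (keys_rows lt_i) in uK uE *.
have [v||u' [u'E u'u]] := sig_loc_pair_move (g' := blk j A1) uK _ uE _.
- by move=> vK; have [? ?] := uniq_pair_neq uK vK; apply: off.
- have := cA (i, j); have := cA (i.+1, j).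
  have := cA (i, j.+1); have := cA (i.+1, j.+1).
  rewrite /blk /plus_of /minus_of /=.
  case: (eqVneq t (true, j)) => [tj|tj].
    move: tQ tpos; rewrite tj !xpair_eqE /= => -[_ /(_ erefl)[? ?]] _ *.
    by constructor 2; split; try congr (_, _); lia.
  case: (eqVneq t (true, j.+1)) => [tj'|tj'].
    move: tQ tpos; rewrite tj' !xpair_eqE /= => -[/(_ erefl) ? _] *.
    by constructor 3; split; try congr (_, _); lia.
  move=> c1 c2 c3 c4; constructor 1; move: tj tj' t_lt c1 c2 c3 c4.
  by case: (t) => [[] y] /=; rewrite !xpair_eqE /= => *;
    split; congr (_, _); lia.
exists u'; split=> //; case: u'u => [|[uq u'p gq ?]]; first by left.
right; split=> //; move: gq; have [_ gt0] := sig_loc_mem uE; move: gt0.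
rewrite uq /blk /plus_of /minus_of /= => gt0 [e1 e2].
have := cA (i.+1, j); have := cA (i.+1, j.+1).
rewrite e1 e2 /plus_of /minus_of.
by case: (t) t_lt => [[] y] /=; rewrite !xpair_eqE /= => ? ? ?;
  first [exfalso; lia | congr (_, _); lia].
Qed.

Lemma f_move_pair' (n i j : nat) (A A1 A2 : kostant n) (t u : key) :
  i.+1 < j -> j.+1 < n -> f_move i A A1 t -> f_move j A A2 u ->
  exists t', sig_loc (blk i A2) 0 (keys n) = Some t'
    /\ (t' = t \/ [/\ u = (false, i.+1), t = (true, j) & t' = (true, j.+1)]).
Proof.
move=> lt_ij lt_j AA1 AA2; have lt_i : i.+1 < n by lia.
have [upos u_lt] := f_move_bounds AA2; have cA := f_move_cnt AA2.
have [tE _] := AA1; have [uE _] := AA2.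
have uK : uniq (keys n) := keys_uniq n.
have uQ := sig_loc_row lt_i uE.
have off v : v != (true, j.+1) -> v != (true, j) ->
    blk i A2 v = blk i A v.
  move=> vp vq; have := cA (plus_of i v); have := cA (minus_of i v).
  rewrite /blk /plus_of /minus_of; move: vp vq u_lt.
  by case: v u {AA2 uE uQ cA upos} => [[] x] [[] y] /=; rewrite !xpair_eqE /=;
    move=> *; congr (_, _); lia.
rewrite (keys_cols lt_j) in uK tE *.
have [v||t' [t'E t't]] := sig_loc_pair_move (g' := blk i A2) uK _ tE _.
- by move=> vK; have [? ?] := uniq_pair_neq uK vK; apply: off.
- have := cA (i, j); have := cA (i.+1, j).
  have := cA (i, j.+1); have := cA (i.+1, j.+1).
  rewrite /blk /plus_of /minus_of /=.
  case: (eqVneq u (false, i.+1)) => [ui|ui].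
    move: uQ upos; rewrite ui !xpair_eqE /= => -[_ /(_ erefl)[? ?]] _ *.
    by constructor 2; split; try congr (_, _); lia.
  case: (eqVneq u (false, i)) => [ui'|ui'].
    move: uQ upos; rewrite ui' !xpair_eqE /= => -[/(_ erefl) ? _] *.
    by constructor 3; split; try congr (_, _); lia.
  move=> c1 c2 c3 c4; constructor 1; move: ui ui' u_lt c1 c2 c3 c4.
  by case: (u) => [[] y] /=; rewrite !xpair_eqE /= => *;
    split; congr (_, _); lia.
exists t'; split=> //; case: t't => [|[tq t'p gq ?]]; first by left.
right; split=> //; move: gq; have [_ gt0] := sig_loc_mem tE; move: gt0.
rewrite tq /blk /plus_of /minus_of /= => gt0 [e1 e2].
have := cA (i.+1, j); have := cA (i, j).
rewrite e1 e2 /plus_of /minus_of.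
by case: (u) u_lt => [[] y] /=; rewrite !xpair_eqE /= => ? ? ?;
  first [exfalso; lia | congr (_, _); lia].
Qed.

(** Either both operators keep their blocks, or both want the root (i+1, j) and each displaces the
    other; then both orders carry it to (i, j+1). *)
Lemma f_op_comm (n : nat) (i j : 'I_n.-1) (A A1 A2 : kostant n) :
  i.+1 < j -> f_op i A = Some A1 -> f_op j A = Some A2 ->
  exists A3, f_op j A1 = Some A3 /\ f_op i A2 = Some A3.
Proof.
move=> lt_ij /f_opP[t AA1] /f_opP[u AA2].
have lt_j : j.+1 < n by have := ltn_ord j; lia.
have [u' [u'E u'u]] := f_move_pair lt_ij lt_j AA1 AA2.
have [t' [t'E t't]] := f_move_pair' lt_ij lt_j AA1 AA2.
have [A3 [fA1 A1A3]] := f_op_some u'E; have [A4 [fA2 A2A4]] := f_op_some t'E.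
exists A3; split=> //; rewrite fA2; congr Some.
apply: cnt_inj => p.
have cA1 := f_move_cnt AA1; have cA2 := f_move_cnt AA2.
have := f_move_cnt A1A3 p; have := f_move_cnt A2A4 p.
have := cA1 p; have := cA2 p.
case: u'u t't => [eu|[et eu ->]] [et'|[eu' et' ->]].
- by rewrite eu et'; lia.
(* If only one operator were displaced, the locations before and after the other move would give
   contradictory inequalities between the multiplicities of (i, j) and (i+1, j+1). *)
- have lt_i : i.+1 < n by lia.
  have [_ /(_ et')[? _]] := sig_loc_col lt_j (proj1 AA1).
  rewrite eu eu' in u'E; have [_ /(_ erefl)[? _]] := sig_loc_row lt_i u'E.
  have := cA1 (i : nat, j : nat); have := cA1 (i.+1, j.+1).
  by rewrite et' /plus_of /minus_of /= !xpair_eqE /=; lia.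
- have lt_i : i.+1 < n by lia.
  have [_ /(_ eu)[? _]] := sig_loc_row lt_i (proj1 AA2).
  rewrite et' et in t'E; have [_ /(_ erefl)[? _]] := sig_loc_col lt_j t'E.
  have := cA2 (i : nat, j : nat); have := cA2 (i.+1, j.+1).
  by rewrite eu /plus_of /minus_of /= !xpair_eqE /=; lia.
rewrite et eu /plus_of /minus_of /=.
move: (p == (i.+1, _)) (p == (_, j.+1)) => *; lia.
Qed.

(** * Encoding by words in three letters *)

(** The roots (h, i), (h, i+1), (h, i+2) are read as 1, 2, 3 and (i, j), (i+1, j), (i+2, j) as 1*,
    2*, 3*; f_i and f_(i+1) then act as f_1 and f_2 on one word. *)
Definition key_factor (n : nat) (i : nat) (A : kostant n) (t : key) : factor :=
  (t.1, if t.1 then (cnt A (i.+2, t.2), cnt A (i.+1, t.2), cnt A (i, t.2))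
        else (cnt A (t.2, i), cnt A (t.2, i.+1), cnt A (t.2, i.+2))).

Lemma fac_blk_key (n i : nat) (A : kostant n) (k : bool) (t : key) :
  fac_blk k (key_factor i A t) = blk (i + k) A t.
Proof.
by case: t => [[] h]; case: k;
  rewrite /fac_blk /blk /plus_of /minus_of /= ?addn0 ?addn1.
Qed.

(** A word in 3 and 1* only, on which f_1 and f_2 vanish: a lowest weight element with [m false]
    signs - for f_1 and [m true] for f_2. *)
Definition mid_factors (m : bool -> nat) : seq factor :=
  [:: (true, (0, 0, m false)); (false, (0, 0, m true))].

Definition encode (n i : nat) (K1 K2 : seq key) (m : bool -> nat)
    (A : kostant n) : seq factor :=
  [seq key_factor i A t | t <- K1] ++ mid_factors m
    ++ [seq key_factor i A t | t <- K2].

(* The blocks of the two keys [ta] and [tb], which duplicate entries recorded *)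
(* elsewhere, have no uncancelled + in either word, and always the same       *)
(* number of uncancelled -.                                                   *)
Definition lowest_pair (n i : nat) (ta tb : key) (m : bool -> nat)
    (A : kostant n) : Prop :=
  forall (k : bool) (e : nat),
    sig_loc (blk (i + k) A) e [:: ta; tb] = None
    /\ sig_eps (blk (i + k) A) e [:: ta; tb] = m k + e.

Lemma sig_eps_map (T U : Type) (h : T -> U) (g : U -> nat * nat) (e : nat)
    (s : seq T) :
  sig_eps g e (map h s) = sig_eps (fun t => g (h t)) e s.
Proof. by elim: s => //= t s ->. Qed.

Lemma sig_sum_map (T U : Type) (h : T -> U) (g : U -> nat * nat)
    (s : seq T) :
  sig_sum1 g (map h s) = sig_sum1 (fun t => g (h t)) s
  /\ sig_sum2 g (map h s) = sig_sum2 (fun t => g (h t)) s.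
Proof. by elim: s => //= t s [-> ->]. Qed.

Lemma eq_sig_eps (T : Type) (g g' : T -> nat * nat) (e : nat) (s : seq T) :
  g =1 g' -> sig_eps g e s = sig_eps g' e s.
Proof. by move=> gg'; elim: s => //= t s ->; rewrite gg'. Qed.

Lemma sig_eps_encode (n i : nat) (K : seq key) (A : kostant n) (k : bool)
    (e : nat) :
  sig_eps (fac_blk k) e [seq key_factor i A t | t <- K]
  = sig_eps (blk (i + k) A) e K.
Proof.
rewrite sig_eps_map; apply: eq_sig_eps => t; exact: fac_blk_key.
Qed.

Lemma sig_eps_mid (m : bool -> nat) (k : bool) (e : nat) :
  sig_eps (fac_blk k) e (mid_factors m) = m k + e.
Proof. by case: k; rewrite /mid_factors /fac_blk /=; lia. Qed.

Lemma sig_move_cat (T : Type) (g : T -> nat * nat) (mv : T -> T)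
    (s1 s2 : seq T) :
  sig_loc g (sig_eps g 0 s2) s1 = None ->
  sig_move g mv (s1 ++ s2) = omap (cat s1) (sig_move g mv s2).
Proof.
elim: s1 => [_|t s1 IH] /=; first by case: sig_move.
by rewrite sig_eps_cat; case: ifP => // _ /IH ->; case: sig_move.
Qed.

Lemma sig_loc_map (T U : Type) (h : T -> U) (g : U -> nat * nat) (e : nat)
    (s : seq T) :
  sig_loc g e (map h s) = omap h (sig_loc (fun t => g (h t)) e s).
Proof. by elim: s => //= t s ->; rewrite sig_eps_map; case: ifP. Qed.

Lemma eq_sig_loc (T : Type) (g g' : T -> nat * nat) (e : nat) (s : seq T) :
  g =1 g' -> sig_loc g e s = sig_loc g' e s.
Proof.
by move=> gg'; elim: s => //= t s ->; rewrite gg' (eq_sig_eps _ _ gg').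
Qed.

Lemma sig_move_map (T U : eqType) (g : T -> nat * nat) (g' : U -> nat * nat)
    (mv : U -> U) (h h' : T -> U) (s : seq T) (s2 : seq U) (t : T) :
  uniq s -> (forall u, g' (h u) = g u) ->
  sig_loc g (sig_eps g' 0 s2) s = Some t ->
  {in s, forall u, u != t -> h' u = h u} -> h' t = mv (h t) ->
  sig_move g' mv (map h s ++ s2) = Some (map h' s ++ s2).
Proof.
move=> + gh + + ht; elim: s => [//|u s IH] /= /andP[us s_uniq].
rewrite sig_eps_cat sig_eps_map (eq_sig_eps _ _ gh) gh.
have mem_s v : v \in s -> v \in u :: s by rewrite inE orbC => ->.
case: ifP => _ => [[ut] hh'|tE hh'].
  rewrite ut -ht; congr (Some (_ :: _ ++ _)); apply/eq_in_map => v vs.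
  by rewrite hh' ?mem_s //; apply: contraNneq us => vt; rewrite ut -vt.
rewrite (IH s_uniq tE) /=; last by move=> v /mem_s; apply: hh'.
rewrite hh' ?mem_head //; apply: contraNneq us => ->.
by case: (sig_loc_mem tE).
Qed.

Lemma sig_loc_lowest (T : eqType) (g : T -> nat * nat) (K1 K2 : seq T)
    (p q t : T) :
  uniq (K1 ++ [:: p; q] ++ K2) ->
  (forall e, sig_loc g e [:: p; q] = None) ->
  sig_loc g 0 (K1 ++ [:: p; q] ++ K2) = Some t -> t != p /\ t != q.
Proof.
move=> uK pqN; rewrite !sig_loc_cat pqN => tE; apply: uniq_pair_neq uK _.
rewrite mem_cat; case E: sig_loc tE => [v|] => [[<-]|/sig_loc_mem[-> _]].
  by case: (sig_loc_mem E) => ->.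
by rewrite orbT.
Qed.

(** The dropped pair lets through as many uncancelled - as its constant replacement and never holds
    the moved +, so the same key moves on both sides. *)
Lemma sig_move_encode (n i : nat) (K1 K2 : seq key) (ta tb : key)
    (m : bool -> nat) (A A' : kostant n) (k : bool) (t : key) :
  keys n = K1 ++ [:: ta; tb] ++ K2 -> lowest_pair i ta tb m A ->
  sig_loc (blk (i + k) A) 0 (keys n) = Some t ->
  {in K1 ++ K2, forall u, u != t -> key_factor i A' u = key_factor i A u} ->
  key_factor i A' t = fac_mv k (key_factor i A t) ->
  sig_move (fac_blk k) (fac_mv k) (encode i K1 K2 m A)
  = Some (encode i K1 K2 m A').
Proof.
move=> eK low + A'off A't; have := keys_uniq n; rewrite {}eK.
rewrite !sig_loc_cat !sig_eps_cat !cat_uniq.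
case/and3P => uK1 K12 /and3P[_ _ uK2].
have off1 : {in K1, forall u, u != t -> key_factor i A' u = key_factor i A u}.
  by move=> u uK; apply: A'off; rewrite mem_cat uK.
have off2 : {in K2, forall u, u != t -> key_factor i A' u = key_factor i A u}.
  by move=> u uK; apply: A'off; rewrite mem_cat uK orbT.
have [midN ->] := low k (sig_eps (blk (i + k) A) 0 K2); rewrite midN.
have blkE := fac_blk_key i A k.
rewrite /encode; case E: sig_loc => [v|] => [[ev]|tE].
  rewrite {v}ev in E; have [tK1 _] := sig_loc_mem E.
  rewrite (sig_move_map (h' := key_factor i A') uK1 blkE _ off1 A't);
    last first.
    by rewrite sig_eps_cat sig_eps_mid sig_eps_encode.
  congr (Some (_ ++ _ ++ _)); apply/eq_in_map => u uK2'; rewrite off2 //.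
  apply: contraNneq K12 => ut; apply/hasP; exists u; last by rewrite /= ut.
  by rewrite mem_cat uK2' orbT.
have [tK2 _] := sig_loc_mem tE.
rewrite sig_move_cat; last first.
  rewrite sig_eps_cat sig_eps_mid sig_eps_encode sig_loc_map.
  by rewrite (eq_sig_loc _ _ blkE) E.
rewrite sig_move_cat; last first.
  rewrite /mid_factors /=; rewrite /fac_blk /=.
  by case: k {low E tE midN A'off A't off1 off2 blkE} => /=; rewrite ?ltn0.
have := @sig_move_map _ _ _ _ (fac_mv k) _ (key_factor i A') _ [::] _
  uK2 blkE tE off2 A't.
rewrite !cats0 => -> /=; congr (Some (_ ++ _)).
apply/eq_in_map => u uK1'; rewrite off1 //.
apply: contraNneq K12 => ut; apply/hasP; exists t; last by rewrite /= -ut.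
by rewrite mem_cat tK2 orbT.
Qed.

Definition mid_key (i : nat) (d b : bool) : key :=
  if d then (true, if b then i.+1 else i.+2)
  else (false, if b then i.+1 else i).

(* The entries (i, i+1), (i, i+2), (i+1, i+2) appear both in rows and in      *)
(* columns; [d] tells whether the columns or the rows are dropped.            *)
Definition mid_cond (n i : nat) (d : bool) (A : kostant n) : Prop :=
  if d then cnt A (i.+1, i.+2) <= cnt A (i, i.+1)
  else cnt A (i, i.+1) <= cnt A (i.+1, i.+2).

Definition mid_weight (n i : nat) (d : bool) (A : kostant n) (k : bool) : nat :=
  let p := cnt A (i, i.+1) in
  let q := cnt A (i, i.+2) in
  let r := cnt A (i.+1, i.+2) in
  if d then (if k then r else p + q - r) else (if k then q + r - p else p).

Lemma mid_lowest (n i : nat) (d : bool) (A : kostant n) :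
  mid_cond i d A ->
  lowest_pair i (mid_key i d false) (mid_key i d true) (mid_weight i d A) A.
Proof.
have c0 x y : y <= x -> cnt A (x, y) = 0.
  by move=> le_yx; apply: cnt_eq0 => /=; lia.
move=> + k e; rewrite /mid_cond /mid_weight /mid_key.
case: d; case: k => /=;
  rewrite /blk /plus_of /minus_of ?addn0 ?addn1 /= ?(c0 i.+2 i.+2)
    ?(c0 i.+2 i.+1) ?(c0 i.+1 i.+1) ?(c0 i.+1 i) ?(c0 i i) //
  => ?; (split; [rewrite ?ifF //; lia | lia]).
Qed.

(** Let p, q, r be the multiplicities of (i, i+1), (i, i+2), (i+1, i+2). When columns are dropped, a
    move can only trade p for q: it fixes r and p + q, and [sig_loc_row] gives r < p before it, so r
    <= p persists. When rows are dropped, r is traded for q, and [sig_loc_col] serves instead. *)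
Lemma mid_move (n i : nat) (d : bool) (A A' : kostant n) (k : bool) (t : key) :
  i.+2 < n -> mid_cond i d A -> f_move (i + k) A A' t ->
  t != mid_key i d false -> t != mid_key i d true ->
  mid_cond i d A' /\ mid_weight i d A' =1 mid_weight i d A.
Proof.
move=> lt_i condA AA' t1 t2; have cA := f_move_cnt AA'.
have [_ t_lt] := f_move_bounds AA'.
have row : [&& k, ~~ t.1 & t.2 == i] -> cnt A (i.+1, i.+2) < cnt A (i, i.+1).
  case: t k {t_lt t1 t2 cA} AA' => [[] h] [] //= AA' /eqP hi.
  have [row _] := sig_loc_row (ltnW lt_i) (proj1 AA').
  by rewrite addn1 hi in row; apply: row.
have col : [&& ~~ k, t.1 & t.2 == i.+2] ->
    cnt A (i, i.+1) < cnt A (i.+1, i.+2).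
  case: t k {t_lt t1 t2 cA row} AA' => [[] h] [] //= AA' /eqP hi.
  have [col _] := sig_loc_col lt_i (proj1 AA').
  by rewrite addn0 hi in col; apply: col.
have := cA (i, i.+1); have := cA (i, i.+2); have := cA (i.+1, i.+2).
move: condA row col t_lt t1 t2 {cA AA'}.
rewrite /mid_cond /mid_weight /mid_key /plus_of /minus_of.
case: t => [[] y]; case: d; case: k; rewrite /= ?addn0 ?addn1 !xpair_eqE /=.
all: by move=> *; split; [lia | case; lia].
Qed.

Lemma key_factor_move (n i : nat) (A A' : kostant n) (k : bool) (t : key) :
  f_move (i + k) A A' t ->
  key_factor i A' t = fac_mv k (key_factor i A t).
Proof.
move=> AA'; have cA := f_move_cnt AA'.
have [_ t_lt] := f_move_bounds AA'.
have := cA (plus_of i t); have := cA (minus_of i t).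
have := cA (plus_of i.+1 t); have := cA (minus_of i.+1 t).
rewrite /key_factor /fac_mv /plus_of /minus_of; move: t_lt {cA AA'}.
case: t => [[] y]; case: k; rewrite /= ?addn0 ?addn1 !xpair_eqE /=.
all: by move=> *; congr (_, (_, _, _)); lia.
Qed.

Lemma key_factor_off (n i : nat) (d : bool) (A A' : kostant n) (k : bool)
    (t u : key) :
  f_move (i + k) A A' t -> u != t ->
  t != mid_key i d false -> t != mid_key i d true ->
  u != mid_key i d false -> u != mid_key i d true ->
  key_factor i A' u = key_factor i A u.
Proof.
move=> AA' ut t1 t2 u1 u2; have cA := f_move_cnt AA'.
have [_ t_lt] := f_move_bounds AA'.
have := cA (plus_of i u); have := cA (minus_of i u).
have := cA (plus_of i.+1 u); have := cA (minus_of i.+1 u).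
rewrite /key_factor /plus_of /minus_of.
move: t_lt ut t1 t2 u1 u2 {cA AA'}; rewrite /mid_key.
case: t u => [[] y] [[] x]; case: d; case: k;
  rewrite /= ?addn0 ?addn1 !xpair_eqE /=.
all: by move=> *; congr (_, (_, _, _)); lia.
Qed.

Definition frame_eq (n i : nat) (A B : kostant n) : Prop :=
  forall p : nat * nat, ~~ (i <= p.1 <= i.+2) -> ~~ (i <= p.2 <= i.+2) ->
    cnt A p = cnt B p.

Lemma f_move_frame (n i : nat) (A A' : kostant n) (k : bool) (t : key) :
  f_move (i + k) A A' t -> frame_eq i A' A.
Proof.
move=> AA' p p1 p2; have := f_move_cnt AA' p.
rewrite [p]surjective_pairing /plus_of /minus_of /=.
by case: (t) => [[] y]; rewrite !xpair_eqE /=; case: k {AA'}; lia.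
Qed.

(** Invariant along a run from [A0]: the choice [d] stays valid, the constant factors stay the same,
    and the roots that the encoding does not see are unchanged. *)
Definition simulates (n i : nat) (d : bool) (m : bool -> nat)
    (A0 A : kostant n) : Prop :=
  [/\ mid_cond i d A, mid_weight i d A =1 m & frame_eq i A A0].

Lemma f_op_encode (n i : nat) (d : bool) (m : bool -> nat) (K1 K2 : seq key)
    (A0 A A' : kostant n) (k : bool) (j : 'I_n.-1) :
  keys n = K1 ++ [:: mid_key i d false; mid_key i d true] ++ K2 ->
  i.+2 < n -> j = i + k :> nat ->
  simulates i d m A0 A -> f_op j A = Some A' ->
  sig_move (fac_blk k) (fac_mv k) (encode i K1 K2 m A)
    = Some (encode i K1 K2 m A') /\ simulates i d m A0 A'.
Proof.
move=> eK lt_i jE [condA mA frameA] /f_opP[t]; rewrite jE => AA'.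
have low : lowest_pair i (mid_key i d false) (mid_key i d true) m A.
  by move=> k' e; rewrite -mA; apply: mid_lowest.
have uK := keys_uniq n; have tE := proj1 AA'.
have [t1 t2] : t != mid_key i d false /\ t != mid_key i d true.
  rewrite eK in uK tE; apply: sig_loc_lowest uK _ tE => e.
  by case: (low k e).
have [condA' mA'] := mid_move lt_i condA AA' t1 t2.
split; last first.
  split=> // [k'|p p1 p2]; first by rewrite mA' mA.
  by rewrite (f_move_frame AA') // frameA.
apply: (sig_move_encode eK low tE _ (key_factor_move AA')) => u uK' ut.
rewrite eK in uK; have [u1 u2] := uniq_pair_neq uK uK'.
exact: (key_factor_off AA' ut t1 t2 u1 u2).
Qed.

Lemma opow_encode (n i : nat) (d : bool) (m : bool -> nat) (K1 K2 : seq key)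
    (A0 A A' : kostant n) (k : bool) (j : 'I_n.-1) (c : nat) :
  keys n = K1 ++ [:: mid_key i d false; mid_key i d true] ++ K2 ->
  i.+2 < n -> j = i + k :> nat ->
  simulates i d m A0 A -> opow (f_op j) c A = Some A' ->
  opow (sig_move (fac_blk k) (fac_mv k)) c (encode i K1 K2 m A)
    = Some (encode i K1 K2 m A') /\ simulates i d m A0 A'.
Proof.
move=> eK lt_i jE; elim: c A => [|c IH] A simA; first by case=> <-.
rewrite !opow_obind; case fA: (f_op j A) => [A1|] // fA1.
have [-> simA1] := f_op_encode eK lt_i jE simA fA.
exact: IH.
Qed.

(** Roots with both ends in {i, i+1, i+2} occur both in a row and in a column, and one of the two
    survives the dropping; roots with one end there occur in a kept key, and the others are given by
    the frame. *)
Lemma encode_inj (n i : nat) (d : bool) (m : bool -> nat) (K1 K2 : seq key)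
    (A B : kostant n) :
  keys n = K1 ++ [:: mid_key i d false; mid_key i d true] ++ K2 ->
  i.+2 < n -> frame_eq i A B ->
  encode i K1 K2 m A = encode i K1 K2 m B -> A = B.
Proof.
move=> eK lt_i frameAB /eqP.
rewrite /encode eqseq_cat ?size_map // eqseq_cat // eqxx /=.
case/andP=> /eqP/eq_in_map eK1 /eqP/eq_in_map eK2.
have facE u : u.2 < n -> u != mid_key i d false -> u != mid_key i d true ->
    key_factor i A u = key_factor i B u.
  rewrite -mem_keys eK !mem_cat !inE => /or3P[/eK1 //||/eK2 //].
  by case/orP=> ->.
apply: cnt_inj => p; case: (boolP (p.1 < p.2 < n)) => [p_lt|pN]; last first.
  by rewrite !cnt_eq0.
have rowE : i <= p.2 <= i.+2 -> (d || ~~ (i <= p.1 <= i.+1)) ->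
    cnt A p = cnt B p.
  case: p p_lt => x y /= xy yi dx.
  have : key_factor i A (false, x) = key_factor i B (false, x).
    by apply: facE; [rewrite /=; lia | |]; rewrite /mid_key;
      case: (d) dx => //=; rewrite xpair_eqE; lia.
  rewrite /key_factor /= => -[e1 e2 e3].
  have : [|| y == i, y == i.+1 | y == i.+2] by lia.
  by case/or3P => /eqP ->.
have colE : i <= p.1 <= i.+2 -> (~~ d || ~~ (i < p.2 <= i.+2)) ->
    cnt A p = cnt B p.
  case: p p_lt {rowE} => x y /= xy yi dx.
  have : key_factor i A (true, y) = key_factor i B (true, y).
    by apply: facE; [rewrite /=; lia | |]; rewrite /mid_key;
      case: (d) dx => //=; rewrite xpair_eqE; lia.
  rewrite /key_factor /= => -[e1 e2 e3].
  have : [|| x == i, x == i.+1 | x == i.+2] by lia.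
  by case/or3P => /eqP ->.
case: (boolP (i <= p.2 <= i.+2)) => p2; last first.
  case: (boolP (i <= p.1 <= i.+2)) => p1; last exact: frameAB.
  by apply: colE => //; lia.
case: (boolP (d || ~~ (i <= p.1 <= i.+1))) => dp; first exact: rowE.
by apply: colE; lia.
Qed.

Lemma sig_sum_cat (T : Type) (g : T -> nat * nat) (s1 s2 : seq T) :
  sig_sum1 g (s1 ++ s2) = sig_sum1 g s1 + sig_sum1 g s2
  /\ sig_sum2 g (s1 ++ s2) = sig_sum2 g s1 + sig_sum2 g s2.
Proof. by elim: s1 => [|t s1 [/= -> ->]] //=; rewrite !addnA. Qed.

Lemma eq_sig_sum (T : Type) (g g' : T -> nat * nat) (s : seq T) :
  g =1 g' -> sig_sum1 g s = sig_sum1 g' s /\ sig_sum2 g s = sig_sum2 g' s.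
Proof. by move=> gg'; elim: s => //= t s [-> ->]; rewrite gg'. Qed.

(** All + of the dropped pair are cancelled, so it and its constant replacement have the same
    difference of signs, -m k. *)
Lemma encode_sum (n i : nat) (ta tb : key) (m : bool -> nat) (K1 K2 : seq key)
    (A : kostant n) (k : bool) :
  keys n = K1 ++ [:: ta; tb] ++ K2 -> lowest_pair i ta tb m A ->
  ((sig_sum1 (fac_blk k) (encode i K1 K2 m A))%:Z
   = weight_of (i + k) A + (sig_sum2 (fac_blk k) (encode i K1 K2 m A))%:Z)%R.
Proof.
move=> eK low; have := weight_of_sums (i + k) A; rewrite eK /encode.
have [locN epsE] := low k 0.
have := sig_phi_eps (blk (i + k) A) 0 [:: ta; tb].
rewrite (sig_loc_none locN) epsE.
have sumE K := sig_sum_map (key_factor i A) (fac_blk k) K.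
have blkE K := eq_sig_sum K (fac_blk_key i A k).
rewrite !(sig_sum_cat _ _ _).1 !(sig_sum_cat _ _ _).2.
rewrite !(sumE _).1 !(sumE _).2 !(blkE _).1 !(blkE _).2.
have [-> ->] : sig_sum1 (fac_blk k) (mid_factors m) = 0
    /\ sig_sum2 (fac_blk k) (mid_factors m) = m k.
  by case: k {locN epsE sumE blkE}; rewrite /mid_factors /fac_blk /=; lia.
by lia.
Qed.

(** Both composites are assumed to exist; their encodings agree by [factor_braid], and [encode_inj]
    recovers the multisets. *)
Lemma f_op_braid (n : nat) (i j : 'I_n.-1) (A B B' : kostant n) (a b : nat) :
  j = i.+1 :> nat ->
  (a%:Z <= weight_of i A)%R -> (b%:Z <= weight_of j A)%R ->
  obind (opow (f_op j) a) (obind (opow (f_op i) (a + b))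
    (opow (f_op j) b A)) = Some B ->
  obind (opow (f_op i) b) (obind (opow (f_op j) (a + b))
    (opow (f_op i) a A)) = Some B' ->
  B = B'.
Proof.
move=> jE le_a le_b.
have lt_i : i.+2 < n by have := ltn_ord j; lia.
pose d := cnt A (i.+1, i.+2) <= cnt A (i : nat, i.+1).
have condA : mid_cond i d A.
  by rewrite /mid_cond; case: ifP; rewrite /d => //; lia.
have [K1 [K2 eK]] : exists K1 K2,
    keys n = K1 ++ [:: mid_key i d false; mid_key i d true] ++ K2.
  rewrite /mid_key; case: (d).
    by rewrite (keys_cols lt_i); do 2!eexists.
  by rewrite (keys_rows (ltnW lt_i)); do 2!eexists.
pose m := mid_weight i d A.
have simA : simulates i d m A A by split.
have jk : j = i + true :> nat by rewrite jE addn1.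
have ik : i = i + false :> nat by rewrite addn0.
have step := fun k l A1 A2 c e =>
  @opow_encode n i d m K1 K2 A A1 A2 k l c eK lt_i e.
case EA1: (opow _ _ A) => [A1|] //=; case EA2: (opow _ _ A1) => [A2|] //= EB.
case EB1: (opow _ _ A) => [B1|] //=; case EB2: (opow _ _ B1) => [B2|] //= EB'.
have [sA1 simA1] := step _ _ _ _ _ jk simA EA1.
have [sA2 simA2] := step _ _ _ _ _ ik simA1 EA2.
have [sB [_ _ frameB]] := step _ _ _ _ _ jk simA2 EB.
have [sB1 simB1] := step _ _ _ _ _ ik simA EB1.
have [sB2 simB2] := step _ _ _ _ _ jk simB1 EB2.
have [sB' [_ _ frameB']] := step _ _ _ _ _ ik simB2 EB'.
apply: (encode_inj (m := m) eK lt_i).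
  by move=> p p1 p2; rewrite frameB // frameB'.
have low := mid_lowest condA.
have := encode_sum false eK low; have := encode_sum true eK low.
rewrite -ik -jk => sum_j sum_i.
have [||y []] := @factor_braid a b (encode i K1 K2 m A).
- by move: sum_i; rewrite /m; lia.
- by move: sum_j; rewrite /m; lia.
rewrite sA1 /= sA2 /= sB => -[->].
by rewrite sB1 /= sB2 /= sB' => -[->].
Qed.

(** * The operators phi *)

Local Open Scope ring_scope.

Lemma pairing_reflection (n : nat) (y : weight n) (i j : 'I_n.-1) :
  pairing (weyl_act (simple_reflection j) y) i
  = pairing y i + pairing y j *+ ((i.+1 == j) || (i == j.+1 :> nat))
    - pairing y j *+ ((i == j) + (i == j)).
Proof.
rewrite -[y]reprK weyl_act_pi !pairing_pi !mxE tpermV.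
move: (repr y 0) => v; rewrite /simple_reflection.
have loE (k : 'I_n.-1) : lo k = k :> nat by [].
have hiE (k : 'I_n.-1) : hi k = k.+1 :> nat by [].
case: (eqVneq i j) => [->|ne_ij].
  rewrite tpermL tpermR.
  rewrite (_ : (j.+1 == j) || (j == j.+1 :> nat) = false); last lia.
  by rewrite mulr0n -[(_ + _)%N]/2%N mulr2n; lia.
have ne_ij' : (i : nat) != j by [].
case: (eqVneq i.+1 j) => [ij|ne1].
  have <- : lo j = hi i by apply: val_inj; rewrite /= ij.
  rewrite tpermL tpermD; try by rewrite -val_eqE /=; lia.
  by rewrite mulr1n mulr0n subr0; lia.
case: (eqVneq (i : nat) j.+1) => [ij|ne2].
  have <- : hi j = lo i by apply: val_inj; rewrite /= ij.
  rewrite tpermR tpermD; try by rewrite -val_eqE /=; lia.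
  by rewrite mulr1n mulr0n subr0; lia.
rewrite !tpermD; try by rewrite -val_eqE /=; lia.
by rewrite !mulr0n addr0 subr0.
Qed.

Lemma pairing_rho (n : nat) (i : 'I_n.-1) : pairing (rho n) i = 1.
Proof. by rewrite pairing_pi !mxE /=; have := ltn_ord i; lia. Qed.

(** The weight is -k_i plus the pairing of mu + rho, which is at least 1 since mu is dominant. *)
Lemma in_S_weight (n : nat) (lam mu : weight n) (w : 'S_n) (A : kostant n)
    (i : 'I_n.-1) :
  dominant mu -> in_S lam mu w A ->
  - pairing (weyl_act w (lam + rho n)) i <= weight_of i A.
Proof.
move=> mu_dom AS; have := pairing_kostant_weight A i.
have := pairingD (kostant_weight A) (mu + rho n) i.
rewrite {1}AS subrK pairingD pairing_rho; have := mu_dom i; lia.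
Qed.

Lemma phi_comp_rcons (n : nat) (lam : weight n) (s : seq 'I_n.-1)
    (j : 'I_n.-1) (w : 'S_n) (A : kostant n) :
  pairing (weyl_act w (lam + rho n)) j < 0 ->
  phi_comp lam (rcons s j) w A
  = obind (phi_comp lam s (w * simple_reflection j)%g)
      (opow (f_op j) (absz (pairing (weyl_act w (lam + rho n)) j)%R) A).
Proof.
move=> kj; rewrite /phi_comp foldr_rcons /= /phi_kostant kj.
case: opow => [A'|] //=.
by have -> : foldr (phi lam) None s = None by elim: s => //= i s ->.
Qed.

Lemma phi_comp_far (n : nat) (lam : weight n) (w : 'S_n) (A : kostant n)
    (i j : 'I_n.-1) :
  1 < `|i%:Z - j%:Z| ->
  pairing (weyl_act w (lam + rho n)) i < 0 ->
  pairing (weyl_act w (lam + rho n)) j < 0 ->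
  phi_comp lam [:: i; j] w A
  = obind (opow (f_op i) (absz (pairing (weyl_act w (lam + rho n)) i)%R))
      (opow (f_op j) (absz (pairing (weyl_act w (lam + rho n)) j)%R) A).
Proof.
move=> far ki kj; rewrite (phi_comp_rcons [:: i]) //.
case: opow => [A'|] //=.
have e : pairing (weyl_act (w * simple_reflection j)%g (lam + rho n)) i
    = pairing (weyl_act w (lam + rho n)) i.
  rewrite weyl_actM pairing_reflection.
  have -> : (i.+1 == j) || (i == j.+1 :> nat) = false by lia.
  have -> : (i == j) = false by rewrite -val_eqE /=; lia.
  by rewrite addr0 subr0.
by rewrite (phi_comp_rcons [::]) e //; case: opow.
Qed.

(** After s_j the pairing with the i-th coroot is k_i + k_j, and after s_i s_j the pairing with the
    j-th is k_i. So all factors are powers of f, with exponents b, a + b, a. *)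
Lemma phi_comp_adj (n : nat) (lam : weight n) (w : 'S_n) (A : kostant n)
    (i j : 'I_n.-1) :
  `|i%:Z - j%:Z| = 1 ->
  pairing (weyl_act w (lam + rho n)) i < 0 ->
  pairing (weyl_act w (lam + rho n)) j < 0 ->
  let a := (absz (pairing (weyl_act w (lam + rho n)) i)%R) in
  let b := (absz (pairing (weyl_act w (lam + rho n)) j)%R) in
  phi_comp lam [:: j; i; j] w A
  = obind (opow (f_op j) a) (obind (opow (f_op i) (a + b)) (opow (f_op j) b A)).
Proof.
move=> adj ki kj a b; rewrite (phi_comp_rcons [:: j; i]) //.
case: opow => [A1|] //=.
have e1 : pairing (weyl_act (w * simple_reflection j)%g (lam + rho n)) i
    = pairing (weyl_act w (lam + rho n)) i
      + pairing (weyl_act w (lam + rho n)) j.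
  rewrite weyl_actM pairing_reflection.
  have -> : (i.+1 == j) || (i == j.+1 :> nat) by lia.
  have -> : (i == j) = false by rewrite -val_eqE /=; lia.
  by rewrite mulr1n subr0.
have e2 : pairing (weyl_act (w * simple_reflection j)%g (lam + rho n)) j
    = - pairing (weyl_act w (lam + rho n)) j.
  rewrite weyl_actM pairing_reflection eqxx.
  have -> : (j.+1 == j) || (j == j.+1 :> nat) = false by lia.
  by rewrite mulr0n; lia.
have e3 : pairing (weyl_act (w * simple_reflection j * simple_reflection i)%g
      (lam + rho n)) j = pairing (weyl_act w (lam + rho n)) i.
  rewrite weyl_actM pairing_reflection e1 e2.
  have -> : (j.+1 == i) || (j == i.+1 :> nat) by lia.
  have -> : (j == i) = false by rewrite -val_eqE /=; lia.
  by rewrite mulr1n; lia.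
rewrite (phi_comp_rcons [:: j]) e1; last lia.
have -> : absz (pairing (weyl_act w (lam + rho n)) i
    + pairing (weyl_act w (lam + rho n)) j)%R = (a + b)%N by lia.
case: opow => [A2|] //=.
by rewrite (phi_comp_rcons [::]) e3 //; case: opow.
Qed.

(** The weights suffice at each step: f_j^b raises the i-weight to at least a + b and leaves the
    j-weight at least -b, which f_i^(a+b) then raises to at least a. *)
Lemma phi_comp_adj_some (n : nat) (lam mu : weight n) (w : 'S_n)
    (A : kostant n) (i j : 'I_n.-1) :
  dominant mu -> in_S lam mu w A -> `|i%:Z - j%:Z| = 1 ->
  pairing (weyl_act w (lam + rho n)) i < 0 ->
  pairing (weyl_act w (lam + rho n)) j < 0 ->
  phi_comp lam [:: j; i; j] w A <> None.
Proof.
move=> mu_dom AS adj ki kj; rewrite (phi_comp_adj _ adj ki kj) /=.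
have wi := in_S_weight i mu_dom AS; have wj := in_S_weight j mu_dom AS.
move: (pairing _ i) (pairing _ j) ki kj wi wj => x y x0 y0 wi wj.
have [|A1 [-> _ w1]] := @opow_f_op n j A (absz y).
  by apply: weight_le_phi; lia.
have w1i := w1 i; have w1j := w1 j.
have [|A2 [/= -> _ w2]] := @opow_f_op n i A1 (absz x + absz y).
  by apply: weight_le_phi; lia.
have w2j := w2 j.
have [|A3 [/= -> _ _]] := @opow_f_op n j A2 (absz x); last by [].
by apply: weight_le_phi; lia.
Qed.

Theorem theorem5p2 (n : nat) (hn : (2 <= n)%N) (lam mu : weight n)
    (lam_dom : dominant lam) (mu_dom : dominant mu)
    (lam_mu : nonneg_root_comb (lam - mu))
    (w : 'S_n) (A : kostant n) (wA_S : in_S lam mu w A)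
    (i j : 'I_n.-1)
    (ki_lt0 : pairing (weyl_act w (lam + rho n)) i < 0)
    (kj_lt0 : pairing (weyl_act w (lam + rho n)) j < 0)
    (phi_i : phi_kostant lam i w A <> None)
    (phi_j : phi_kostant lam j w A <> None) :
  (1 < `|i%:Z - j%:Z| ->
     phi_comp lam [:: i; j] w A = phi_comp lam [:: j; i] w A
     /\ phi_comp lam [:: j; i] w A <> None)
  /\ (`|i%:Z - j%:Z| = 1 ->
     phi_comp lam [:: j; i; j] w A = phi_comp lam [:: i; j; i] w A
     /\ phi_comp lam [:: i; j; i] w A <> None).
Proof.
split=> [far|adj].
  have far' : 1 < `|j%:Z - i%:Z| by rewrite distrC.
  rewrite (phi_comp_far _ far) // (phi_comp_far _ far') //.
  move: phi_i phi_j; rewrite /phi_kostant ki_lt0 kj_lt0.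
  case Ei: (opow (f_op i) _ _) => [Ai|] // _.
  case Ej: (opow (f_op j) _ _) => [Aj|] //= _.
  have [lt_ij|lt_ji] : (i.+1 < j)%N \/ (j.+1 < i)%N by lia.
    have [B [-> ->]] := opow_comm
      (fun A0 A1 A2 => @f_op_comm n i j A0 A1 A2 lt_ij) Ei Ej.
    by [].
  have [B [-> ->]] := opow_comm
    (fun A0 A1 A2 => @f_op_comm n j i A0 A1 A2 lt_ji) Ej Ei.
  by [].
have adj' : `|j%:Z - i%:Z| = 1 by rewrite distrC.
have nz := phi_comp_adj_some mu_dom wA_S adj ki_lt0 kj_lt0.
have nz' := phi_comp_adj_some mu_dom wA_S adj' kj_lt0 ki_lt0.
split=> //; move: nz nz'.
rewrite (phi_comp_adj _ adj) // (phi_comp_adj _ adj') //=.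
have := in_S_weight i mu_dom wA_S; have := in_S_weight j mu_dom wA_S.
set a := absz (pairing _ i); set b := absz (pairing _ j) => wj wi.
case E1: (obind _ (obind _ (opow (f_op j) b A))) => [B1|] // _.
case E2: (obind _ (obind _ (opow (f_op i) a A))) => [B2|] // _; congr Some.
have le_a : a%:Z <= weight_of i A by rewrite /a (ltz0_abs ki_lt0).
have le_b : b%:Z <= weight_of j A by rewrite /b (ltz0_abs kj_lt0).
have [ij|ji] : j = i.+1 :> nat \/ i = j.+1 :> nat by lia.
  by apply: f_op_braid ij le_a le_b E1 _; rewrite addnC.
by apply/esym/(f_op_braid ji le_b le_a E2); rewrite addnC.
Qed.
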